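(* Let $\mathcal{X}$ be an infinite dimensional complex Banach space and let $T\in\mathcal{B}(\mathcal{X})$. Then the following statements are equivalent: (i) $T$ satisfies the generalized Browder's theorem, i.e. $\sigma(T)\setminus\sigma_{BW}(T)=p_0(T)$; (ii) $\sigma_{BW}(T)=\sigma_{BB}(T)$; (iii) $\sigma(T)=\sigma_{BW}(T)\cup\pi_0(T)$; (iv) $\operatorname{acc}\sigma(T)\subseteq\sigma_{BW}(T)$; (v) $\sigma(T)\setminus\sigma_{BW}(T)\subseteq\pi_0(T)$.
   Context: $\mathcal{B}(\mathcal{X})$ is the algebra of bounded linear operators on $\mathcal{X}$ and $\mathcal{B}_{00}(\mathcal{X})$ the set of finite rank operators in it. $N(T)$, $R(T)$ denote null space and range; $\alpha(T)=\dim N(T)$, $\beta(T)=\dim\mathcal{X}/R(T)$. $T$ is Fredholm if $\alpha(T),\beta(T)<\infty$ (and $R(T)$ is closed), with index $i(T)=\alpha(T)-\beta(T)$. For a nonnegative integer $n$, $T_{[n]}$ is the restriction of $T$ to $R(T^n)$, viewed as a map from $R(T^n)$ into $R(T^n)$ ($T_{[0]}=T$). $T$ is $B$-Fredholm if for some $n$ the range $R(T^n)$ is closed and $T_{[n]}$ is Fredholm. The degree of stable iteration of $T$ is $d=\operatorname{dis}T:=\inf\{n\in\mathbb{Z}_+: m\in\mathbb{Z}_+, m\ge n\Rightarrow R(T^n)\cap N(T)\subseteq R(T^m)\cap N(T)\}$; for $B$-Fredholm $T$ the index is $i(T):=i(T_{[d]})$ (and $i(T_{[m]})=i(T_{[d]})$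 for all $m\ge d$). $T$ is $B$-Weyl if it is $B$-Fredholm of index $0$. $\sigma_{BW}(T)=\{\lambda\in\mathbb{C}: T-\lambda\text{ is not }B\text{-Weyl}\}$. $T$ is Drazin invertible if there exist $A\in\mathcal{B}(\mathcal{X})$ and a nonnegative integer $k$ with $T^kAT=T^k$, $ATA=A$, $TA=AT$; $\sigma_D(T)=\{\lambda\in\mathbb{C}:T-\lambda\text{ is not Drazin invertible}\}$. The $B$-Browder spectrum is $\sigma_{BB}(T)=\bigcap\{\sigma_D(T+F):F\in\mathcal{B}_{00}(\mathcal{X}),\ TF=FT\}$. $\sigma(T)$ is the spectrum; $\operatorname{acc}K$ is the set of accumulation points of $K\subseteq\mathbb{C}$; $p_0(T)$ is the set of poles (of the resolvent) of $T$; $\pi_0(T)$ is the set of all eigenvalues of $T$ which are isolated points of $\sigma(T)$. *)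

(* Defs.v *)
From HB Require Import structures.
From mathcomp Require Import all_boot all_order all_algebra.
From mathcomp Require Import all_classical all_reals all_analysis.
From mathcomp Require Export complex.

Set Implicit Arguments.
Unset Strict Implicit.
Unset Printing Implicit Defensive.

Import Order.TTheory GRing.Theory Num.Theory.
Import numFieldNormedType.Exports.

Local Open Scope classical_set_scope.
Local Open Scope ring_scope.

Section Dimension.
Variables (K : numFieldType) (X : lmodType K).
Implicit Types (N M : set X) (n : nat).

(* [N] and [M] are meant to be subspaces with [N `<=` M]; [e] represents a
   basis of M / N. The uniqueness of the coordinates of 0 is the linear
   independence of [e] modulo [N]. *)
Definition basis_mod N M n (e : 'I_n -> X) : Prop :=
  (forall i, M (e i)) /\
  forall x, M x -> exists! a : 'rV[K]_n, N (x - \sum_i a 0 i *: e i).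

Definition has_dim N M n : Prop := exists e : 'I_n -> X, basis_mod N M e.

Definition findim N M : Prop := exists n, has_dim N M n.

(* dim M / N, with the convention that it is 0 if M / N is not
   finite-dimensional. *)
Definition dimq N M : nat := xget 0%N [set n | has_dim N M n].

End Dimension.

Section Operators.
Variables (K : numFieldType) (X : normedModType K).
Implicit Types (T S F : {linear X -> X}) (M : set X) (n : nat) (l : K).

Definition bounded_op T : Prop := bounded_near T (nbhs (0 : X)).

Definition finite_rank_op F : Prop :=
  bounded_op F /\ findim [set 0] (range F).

Definition sub_scalar T l : {linear X -> X} := T \- l \*: idfun.

Definition inverse_op T S : Prop :=
  [/\ bounded_op S, cancel T S & cancel S T].

Definition spectrum T : set K :=
  [set l | ~ exists S, inverse_op (sub_scalar T l) S].

(* [M] is a subspace with [T @` M `<=` M]; the next definitions concern the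
   restriction of [T] to [M], as an operator from [M] to [M]. *)
Definition null_on M T : set X := M `&` [set x | T x = 0].

Definition fredholm_on M T : Prop :=
  [/\ findim [set 0] (null_on M T),
      findim (T @` M) M
    & closed (T @` M : set (subspace M))].

Definition index_on M T : int :=
  (dimq [set 0] (null_on M T))%:Z - (dimq (T @` M) M)%:Z.

Definition range_iter T n : set X := range (iter n T).

Definition Bfredholm T : Prop :=
  exists n, closed (range_iter T n) /\ fredholm_on (range_iter T n) T.

Definition stable_from T n : Prop := forall m, (n <= m)%N ->
  range_iter T n `&` null_on setT T `<=` range_iter T m `&` null_on setT T.

(* The degree of stable iteration; if it is infinite, which does not happen
   for a B-Fredholm operator, the value is 0. *)
Definition dis T : nat := xget 0%N
  [set d | stable_from T d /\ forall n, stable_from T n -> (d <= n)%N].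

Definition Bindex T : int := index_on (range_iter T (dis T)) T.

Definition Bweyl T : Prop := Bfredholm T /\ Bindex T = 0.

Definition Bweyl_spectrum T : set K := [set l | ~ Bweyl (sub_scalar T l)].

Definition drazin_invertible T : Prop :=
  exists (A : {linear X -> X}) (k : nat), [/\ bounded_op A,
    iter k T \o A \o T =1 iter k T,
    A \o T \o A =1 A
  & T \o A =1 A \o T].

Definition drazin_spectrum T : set K :=
  [set l | ~ drazin_invertible (sub_scalar T l)].

Definition Bbrowder_spectrum T : set K :=
  \bigcap_(F in [set F : {linear X -> X} |
                  finite_rank_op F /\ T \o F =1 F \o T])
    drazin_spectrum (T \+ F).

(* Convergence in the operator norm. *)
Definition op_cvg (u : nat -> X -> X) (S : X -> X) : Prop :=
  forall e : K, 0 < e ->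
    \forall N \near \oo, forall x, `|u N x - S x| <= e * `|x|.

(* [l] is a pole of order [p] of the resolvent: on a punctured disc around the
   isolated point [l] of the spectrum, the resolvent has the Laurent expansion
   sum_n (z - l) ^ (n - p) A_n with A_0 <> 0. The resolvent is taken to be
   (T - z)^-1; replacing it by (z - T)^-1 changes the sign of the A_n. *)
Definition pole_of_order T l (p : nat) : Prop :=
  isolated (spectrum T) l /\
  exists (A : nat -> {linear X -> X}) (r : K),
    [/\ forall n, bounded_op (A n),
        exists x, A 0%N x != 0,
        0 < r
      & forall z, 0 < `|z - l| < r ->
        exists S, inverse_op (sub_scalar T z) S /\
          op_cvg (fun N x =>
            (z - l) ^- p *: \sum_(n < N) (z - l) ^+ n *: A n x) S].

Definition poles T : set K :=
  [set l | exists p, (0 < p)%N /\ pole_of_order T l p].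

Definition eigenvalues T : set K :=
  [set l | exists x : X, x != 0 /\ T x = l *: x].

Definition isolated_eigenvalues T : set K :=
  eigenvalues T `&` isolated (spectrum T).

End Operators.

(* Main.v *)
(* By linearity one may fix [t = T - l]. The whole statement follows from:
   (a) [t] Drazin invertible implies [t] B-Weyl; (b) [t] Drazin invertible and
   not invertible if and only if [l] is a pole, and poles are eigenvalues;
   (c) [t] B-Weyl and [l] not an accumulation point of the spectrum imply [t]
   Drazin invertible; (d) the B-Browder spectrum is the Drazin spectrum.

   The core is (c). For [m] large, [V = R(t^m)] and [t V] are closed and
   [N(t) `&` V] is contained in every [R(t^k)]. If [x_0 != 0] lies in
   [N(t) `&` V], the open mapping theorem yields [x_k] in [V] with
   [t x_(k+1) = x_k] and [|x_k| <= c^k |x_0|]; then [\sum_k w^k x_k] is an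
   eigenvector of [t] for every small [w], against the isolation of [l]. So [t]
   is injective on [V]; as the index is 0, it is bijective on [V], and a last
   use of the open mapping theorem makes the Drazin inverse bounded.

   For (b), the Laurent expansion is explicit in terms of the Drazin inverse;
   conversely comparing coefficients in [(t - w) S_w = 1 = S_w (t - w)] gives
   [t^p.+1 A_p = t^p] with [A_p] commuting with [t].

   For (d), if [f] has finite rank and commutes with [t], then [t] satisfies a
   polynomial equation on the range of [f], hence [t^j f = t^j.+1 c f] with [c]
   a polynomial in [t], and a Drazin inverse of [t + f] can be corrected. *)
Require Import Defs.
From HB Require Import structures.
From mathcomp Require Import all_boot all_order all_algebra.
From mathcomp Require Import all_classical all_reals all_analysis.
From mathcomp Require Import complex.
From mathcomp Require Import ring lra.

Set Implicit Arguments.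
Unset Strict Implicit.
Unset Printing Implicit Defensive.

Import Order.TTheory GRing.Theory Num.Theory.
Import numFieldNormedType.Exports.

Local Open Scope classical_set_scope.
Local Open Scope ring_scope.

(** * Real-valued norms and boundedness *)

Section RealNorm.
Variables (R : realType) (X : normedModType R[i]).
Implicit Types (x y : X) (a : R[i]).

(* The norm of [X] takes its values in [R[i]]; [nrm] and [cnrm] are the
   corresponding real numbers. *)
Definition nrm x : R := complex.Re `|x|.

Lemma nrmE x : `|x| = real_complex R (nrm x).
Proof. by rewrite RRe_real. Qed.

Definition cnrm a : R := complex.Re `|a|.

Lemma cnrmE a : `|a| = real_complex R (cnrm a).
Proof. by rewrite RRe_real. Qed.

Lemma nrm_ge0 x : 0 <= nrm x.
Proof. by rewrite -ler0c -nrmE. Qed.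

Lemma cnrm_ge0 a : 0 <= cnrm a.
Proof. by rewrite -ler0c -cnrmE. Qed.

Lemma nrm0 : nrm 0 = 0.
Proof. by rewrite /nrm normr0. Qed.

Lemma nrm_eq0 x : nrm x = 0 -> x = 0.
Proof. by move=> x0; apply/eqP; rewrite -normr_eq0 nrmE x0. Qed.

Lemma nrm_gt0 x : x != 0 -> 0 < nrm x.
Proof.
by rewrite lt_def nrm_ge0 andbT => /eqP x0; apply/eqP => /nrm_eq0.
Qed.

Lemma nrmD x y : nrm (x + y) <= nrm x + nrm y.
Proof. by rewrite -lecR rmorphD/= -!nrmE ler_normD. Qed.

Lemma nrmN x : nrm (- x) = nrm x.
Proof. by rewrite /nrm normrN. Qed.

Lemma nrm_distC x y : nrm (x - y) = nrm (y - x).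
Proof. by rewrite -nrmN opprB. Qed.

Lemma nrmZ a x : nrm (a *: x) = cnrm a * nrm x.
Proof. by apply: complexI; rewrite rmorphM/= -!nrmE -cnrmE normrZ. Qed.

Lemma nrmB_trans y x z : nrm (x - z) <= nrm (x - y) + nrm (y - z).
Proof. by have := nrmD (x - y) (y - z); rewrite addrA subrK. Qed.

Lemma cnrm_real (r : R) : 0 <= r -> cnrm (real_complex R r) = r.
Proof.
by move=> r0; apply: complexI; rewrite -cnrmE ger0_norm// ler0c.
Qed.

Lemma cnrmX a n : cnrm (a ^+ n) = cnrm a ^+ n.
Proof. by apply: complexI; rewrite rmorphXn/= -!cnrmE normrX. Qed.

Lemma cnrm_gt0 a : a != 0 -> 0 < cnrm a.
Proof.
rewrite lt_def cnrm_ge0 andbT; apply: contraNneq => a0.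
by rewrite -normr_eq0 cnrmE a0.
Qed.

Lemma half_exp_small (e : R) : 0 < e -> exists n, 2^-1 ^+ n < e.
Proof.
move=> e0; exists (Num.truncn e^-1).+1.
rewrite exprVn -[ltRHS]invrK ltf_pV2 ?posrE ?invr_gt0 ?exprn_gt0//.
rewrite (lt_trans (truncnS_gt _))// -natrX ltr_nat.
by rewrite ltn_expl.
Qed.

Lemma bounded_opP (T : {linear X -> X}) :
  bounded_op T <-> exists c : R, forall x, nrm (T x) <= c * nrm x.
Proof.
split=> [/linear_boundedP/pinfty_ex_gt0[M M0 TM]|[c Tc]].
  exists (complex.Re M) => x.
  by rewrite -lecR rmorphM/= -!nrmE RRe_real ?gtr0_real.
apply/linear_boundedP; exists (real_complex R c); split.
  by apply/complex_realP; exists c.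
move=> r cr x; rewrite (le_trans _ (ler_wpM2r _ (ltW cr)))//.
by rewrite !nrmE -rmorphM lecR.
Qed.

Lemma closure_nrmP (A : set X) x :
  closure A x <-> forall e : R, 0 < e -> exists2 y, A y & nrm (x - y) < e.
Proof.
split=> [Ax e e0|Ax U /nbhs_ballP[e e0 xU]].
  have e0' : 0 < real_complex R e by rewrite -[0]/(real_complex R 0) ltcR.
  have [y [Ay]] := Ax _ (nbhsx_ballx x _ e0').
  rewrite -ball_normE/= nrmE ltcR => ?; by exists y.
have e0' : real_complex R (complex.Re e) = e by rewrite RRe_real ?gtr0_real.
have [|y Ay xy] := Ax (complex.Re e).
  by rewrite -ltcR e0'.
exists y; split => //; apply: xU; rewrite -ball_normE/= -e0'.
by rewrite nrmE ltcR.
Qed.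

Lemma closed_nrmP (A : set X) : closed A ->
  forall x, (forall e : R, 0 < e -> exists2 y, A y & nrm (x - y) < e) -> A x.
Proof. by move=> cA x /closure_nrmP/cA. Qed.

End RealNorm.

(** * Convergence of geometrically bounded series *)

Section Complete.
Variables (R : realType) (X : completeNormedModType R[i]).

(** The explicit tail bound is part of the conclusion because later arguments pass to the limit only
    by comparing with partial sums at rate [2^-1 ^+ n]. *)
Lemma nrm_geometric_cvg (u : nat -> X) (c : R) :
  (forall n, nrm (u n) <= c * 2^-1 ^+ n) ->
  exists s, forall n, nrm (s - \sum_(k < n) u k) <= c * 2 * 2^-1 ^+ n.
Proof.
move=> uc; pose S n := \sum_(k < n) u k.
have c0 : 0 <= c by have := uc 0; rewrite expr0 mulr1; apply/le_trans/nrm_ge0.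
(* Subtracting the remaining tail makes the induction on [m] close. *)
have SS n m : nrm (S (n + m)%N - S n) <= c * 2 * 2^-1 ^+ n - c * 2 * 2^-1 ^+ (n + m).
  elim: m => [|m IH]; first by rewrite addn0 !subrr nrm0.
  rewrite addnS /S big_ord_recr/= -/(S _) addrAC (le_trans (nrmD _ _))//.
  rewrite (le_trans (lerD IH (uc _)))// exprS.
  by set p := 2^-1 ^+ n; set q := 2^-1 ^+ (n + m); nra.
have {}SS n m : (n <= m)%N -> nrm (S m - S n) <= c * 2 * 2^-1 ^+ n.
  move=> nm; rewrite -(subnKC nm) (le_trans (SS _ _))// gerBl.
  by rewrite mulr_ge0 ?exprn_ge0// mulr_ge0.
have small (e : R) : 0 < e -> exists n, c * 2 * 2^-1 ^+ n < e.
  move=> e0; have [|n ne] := @half_exp_small R (e / (c * 2 + 1)).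
    by rewrite divr_gt0//; lra.
  exists n; move: ne; rewrite ltr_pdivlMr; last lra.
  apply: le_lt_trans; rewrite mulrC ler_wpM2l ?exprn_ge0//; lra.
have /cauchy_cvg : cauchy (S @ \oo).
  apply: cauchy_exP => e e0.
  have e0' : real_complex R (complex.Re e) = e by rewrite RRe_real ?gtr0_real.
  have [|n ne] := small (complex.Re e); first by rewrite -ltcR e0'.
  exists (S n), n => // m /= nm; rewrite -ball_normE/= -e0' nrmE ltcR.
  by rewrite nrm_distC (le_lt_trans (SS _ _ nm)).
move=> /cvg_ex[s Ss]; exists s => n; apply/ler_addgt0Pr => e e0.
have e0' : 0 < real_complex R e by rewrite -[0]/(real_complex R 0) ltcR.
have /cvgrPdist_lt/(_ _ e0') [N _ NS] := Ss.
have := NS (maxn n N) (leq_maxr _ _); rewrite /= nrmE ltcR => sN.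
have := SS _ _ (leq_maxl n N).
by have := nrmB_trans (S (maxn n N)) s (S n); lra.
Qed.

End Complete.

(** * The ring of bounded operators *)

Section BoundedOperators.
Variables (R : realType) (X : normedModType R[i]).

(** Stated on bare functions, so that the type carved out by it inherits the module structure of
    [X -> X]. With composition it becomes a ring, where Drazin inverses are handled
    algebraically. *)
Definition bop_pred : {pred X -> X} := [pred f : X -> X |
  `[< linear f /\ exists c : R, forall x, nrm (f x) <= c * nrm x >]].

Fact bop_submod_closed : submod_closed bop_pred.
Proof.
split=> [|a f g /asboolP[lf [c fc]] /asboolP[lg [d gd]]]; apply/asboolP.
  split; first by move=> a x y; rewrite /= scaler0 addr0.
  by exists 0 => x; rewrite mul0r nrm0.
split=> [b x y|].
  by rewrite /= !fctE lf lg !scalerDr !scalerA (mulrC a) addrACA.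
exists (cnrm a * c + d) => x; rewrite (le_trans (nrmD _ _))//.
rewrite mulrDl lerD// nrmZ -mulrA; apply: ler_wpM2l => //; exact: cnrm_ge0.
Qed.

HB.instance Definition _ :=
  GRing.isSubmodClosed.Build R[i] (X -> X) bop_pred bop_submod_closed.

Record bop := Bop { bop_fun :> X -> X; bop_funP : bop_fun \in bop_pred }.

HB.instance Definition _ := [isSub for bop_fun].
HB.instance Definition _ := [Choice of bop by <:].
HB.instance Definition _ := [SubChoice_isSubLmodule of bop by <:].

Lemma bop_linear (f : bop) : linear f.
Proof. by have /asboolP[] := bop_funP f. Qed.

HB.instance Definition _ (f : bop) :=
  GRing.isLinear.Build R[i] X X _ (bop_fun f) (bop_linear f).

(* A shortcut for the slow canonical structure search from [bop_fun]. *)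
Definition bop_lin (f : bop) : {linear X -> X} := f.
Arguments bop_lin f /.
Coercion bop_lin : bop >-> GRing.Linear.type.

Lemma bop_boundP (f : bop) : exists2 c : R, 0 < c & forall x, nrm (f x) <= c * nrm x.
Proof.
have /asboolP[_ [c fc]] := bop_funP f.
exists (Num.max 1 c); first by rewrite lt_max ltr01.
by move=> x; rewrite (le_trans (fc x))// ler_wpM2r ?nrm_ge0// le_max lexx orbT.
Qed.

Lemma bopP (f g : bop) : f =1 g -> f = g.
Proof. by move=> fg; apply/val_inj/funext. Qed.

Fact bop_one_subproof : (@id X) \in bop_pred.
Proof. by apply/asboolP; split=> //; exists 1 => x; rewrite mul1r. Qed.

Fact bop_mul_subproof (f g : bop) : (f \o g : X -> X) \in bop_pred.
Proof.
apply/asboolP; split=> [a x y|]; first by rewrite /= !linearP.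
have [c c0 fc] := bop_boundP f; have [d d0 gd] := bop_boundP g.
exists (c * d) => x; rewrite (le_trans (fc _))// -mulrA.
apply: ler_wpM2l (gd x); exact: ltW.
Qed.

Definition bop_one : bop := Bop bop_one_subproof.
Definition bop_mul (f g : bop) : bop := Bop (bop_mul_subproof f g).

Fact bop_mulA : associative bop_mul. Proof. by move=> f g h; apply: bopP. Qed.
Fact bop_mul1 : left_id bop_one bop_mul. Proof. by move=> f; apply: bopP. Qed.
Fact bop_mulr1 : right_id bop_one bop_mul. Proof. by move=> f; apply: bopP. Qed.
Fact bop_mulDl : left_distributive bop_mul +%R.
Proof. by move=> f g h; apply: bopP. Qed.
Fact bop_mulDr : right_distributive bop_mul +%R.
Proof. by move=> f g h; apply: bopP => x; exact: linearD. Qed.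

HB.instance Definition _ := GRing.Zmodule_isPzRing.Build bop
  bop_mulA bop_mul1 bop_mulr1 bop_mulDl bop_mulDr.

Lemma bop_scaleAl (a : R[i]) (f g : bop) : a *: (f * g) = (a *: f) * g.
Proof. exact: bopP. Qed.

Lemma bop_scaleAr (a : R[i]) (f g : bop) : a *: (f * g) = f * (a *: g).
Proof. by apply: bopP => x; rewrite [RHS]linearZ. Qed.

Lemma bopM (f g : bop) x : (f * g) x = f (g x). Proof. by []. Qed.
Lemma bop1 x : (1 : bop) x = x. Proof. by []. Qed.
Lemma bopD (f g : bop) x : (f + g) x = f x + g x. Proof. by []. Qed.
Lemma bopN (f : bop) x : (- f) x = - f x. Proof. by []. Qed.
Lemma bopB (f g : bop) x : (f - g) x = f x - g x. Proof. by []. Qed.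
Lemma bop0 x : (0 : bop) x = 0. Proof. by []. Qed.
Lemma bopZ a (f : bop) x : (a *: f) x = a *: f x. Proof. by []. Qed.
Lemma bop_sum n (f : nat -> bop) x :
  (\sum_(i < n) f i) x = \sum_(i < n) f i x.
Proof.
elim: n => [|n IH]; first by rewrite !big_ord0.
by rewrite big_ord_recr bopD IH big_ord_recr.
Qed.
Lemma bopX (f : bop) n x : (f ^+ n) x = iter n f x.
Proof. by elim: n => //= n <-; rewrite exprS. Qed.

Fact bop_of_subproof (T : {linear X -> X}) : bounded_op T -> (T : X -> X) \in bop_pred.
Proof. by move=> /bounded_opP Tb; apply/asboolP; split=> //; exact: linearP. Qed.

Definition bop_of (T : {linear X -> X}) (Tb : bounded_op T) : bop :=
  Bop (bop_of_subproof Tb).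

Lemma bop_bounded (f : bop) : bounded_op f.
Proof. by apply/bounded_opP; have [c _ fc] := bop_boundP f; exists c. Qed.

End BoundedOperators.

(** * Drazin invertibility in a ring *)

Section DrazinRing.
Variable E : pzRingType.
Implicit Types t a b c f : E.

Definition is_drazin t a k := [/\ t ^+ k * a * t = t ^+ k, a * t * a = a & t * a = a * t].

Definition drazin t := exists a k, is_drazin t a k.

(** The Drazin inverse is [t ^+ p * b ^+ p.+1]: the factor [t ^+ p] discards what [b] does where it
    does not invert [t], and iterating the hypothesis gives
    [t ^+ (p + p.+1) * b ^+ p.+1 = t ^+ p]. *)
Lemma drazin_comm_criterion t b p : GRing.comm t b -> t ^+ p.+1 * b = t ^+ p -> drazin t.
Proof.
move=> tb tpb; pose B := b ^+ p.+1.
have tB n : GRing.comm (t ^+ n) B by apply/commrX/commr_sym/commrX.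
have stab : t ^+ (p + p.+1) * B = t ^+ p.
  rewrite exprD -mulrA -exprMn_comm//; elim: p.+1 => [|k IH].
    by rewrite mulr1.
  by rewrite exprS !mulrA -exprSr tpb.
exists (t ^+ p * B), p; split.
- by rewrite mulrA -exprD -mulrA -(tB 1%N) mulrA -exprSr -addnS.
- rewrite -(mulrA _ t) (mulrA t) -exprS -mulrA (mulrA B) -tB !mulrA.
  by rewrite -exprD stab.
- by rewrite mulrA -exprS exprSr -mulrA (tB 1%N) mulrA.
Qed.

(** The idempotent [t * a] splits off the part on which [t] is invertible; on the complementary part
    [t ^+ k] vanishes. *)
Lemma drazin_idem t a k : is_drazin t a k ->
  [/\ (t * a) * (t * a) = t * a, t ^+ k * (t * a) = t ^+ k,
      a * (t * a) = a &
      forall n, t ^+ n * a ^+ n * (t * a) = t * a].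
Proof.
move=> [tka ata ta].
have pp : (t * a) * (t * a) = t * a by rewrite mulrA -(mulrA t) -mulrA ata.
split=> [//|||n].
- by rewrite ta mulrA.
- by rewrite mulrA.
- rewrite -exprMn_comm//; elim: n => [|n IH]; first by rewrite mul1r.
  by rewrite exprSr -mulrA pp.
Qed.

(** The idempotent [p = t * a] has [t ^+ k] as a factor on either side, and [t ^+ k] absorbs [p];
    hence [p * f = p * f * p = f * p]. Then [f * a = p * f * a = a * t * f * a = a * f * p = a *
    f]. *)
Lemma drazin_bicommutant t a k f : is_drazin t a k -> GRing.comm t f -> GRing.comm f a.
Proof.
move=> ta tf; have [pp tkp ap pn] := drazin_idem ta.
case: ta => tka ata ta; set p := t * a in pp tkp ap pn.
have tp : GRing.comm t p by rewrite /GRing.comm /p -mulrA ta.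
have tap : GRing.comm p a by rewrite /GRing.comm ap /p ta.
have tkf : GRing.comm (t ^+ k) f by apply/commr_sym/commrX/commr_sym.
have tkp' : GRing.comm (t ^+ k) p by apply/commr_sym/commrX/commr_sym.
have tka' : GRing.comm (t ^+ k) (a ^+ k) by apply/commrX/commr_sym/commrX.
have pE1 : p = p * a ^+ k * t ^+ k.
  have: GRing.comm p (t ^+ k * a ^+ k).
    by apply: commrM; [apply: commr_sym|apply: commrX].
  by rewrite /GRing.comm pn tka' mulrA => ->.
have pE2 : p = t ^+ k * (a ^+ k * p) by rewrite mulrA pn.
have pf : p * f = p * f * p.
  have h : p * f = p * a ^+ k * f * t ^+ k by rewrite {1}pE1 -mulrA tkf mulrA.
  by rewrite h -(mulrA _ _ p) tkp.
have fp : f * p = p * f * p.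
  have h : f * p = t ^+ k * (f * (a ^+ k * p)) by rewrite {1}pE2 mulrA -tkf -mulrA mulrA.
  by rewrite -mulrA h [RHS]mulrA -tkp' tkp.
have pa : p * a = a by rewrite tap ap.
have h1 : f * a = p * f * a by rewrite -{1}pa mulrA fp -(mulrA _ p) pa.
have h2 : p * f * a = a * (f * p).
  by rewrite /p {1}ta -!mulrA (mulrA t) tf -mulrA.
by rewrite /GRing.comm h1 h2 fp -pf mulrA ap.
Qed.

(** Powers of [t] and [t + f] differ by multiples of [f], so for a Drazin inverse [a] of [t + f] the
    defect [t ^+ k * (1 - t * a)] is a multiple of [f]. After multiplication by [t ^+ j], [c]
    inverts [t] on such multiples, so [a + c * (1 - t * a)] meets the commuting criterion for
    [t]. *)
Lemma drazin_perturb t f c j : GRing.comm t f -> GRing.comm t c ->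
  t ^+ j.+1 * c * f = t ^+ j * f -> drazin (t + f) -> drazin t.
Proof.
move=> tf tc tjf [a [k uak]].
have ut : GRing.comm (t + f) t by apply/commr_sym/commrD.
have ta : GRing.comm t a by exact: drazin_bicommutant uak ut.
case: uak => uk _ ua.
have {}uk : (t + f) ^+ k.+1 * a = (t + f) ^+ k.
  by rewrite exprSr -mulrA ua mulrA.
have dv n : exists g, t ^+ n - (t + f) ^+ n = f * g.
  exists (- (\sum_(i < n) (t + f) ^+ (n.-1 - i) * t ^+ i)).
  by rewrite -opprB subrXX_comm// [t + f]addrC addrK mulrN.
have [g gE] : exists g, t ^+ k - t ^+ k.+1 * a = f * g.
  have [g1 g1E] := dv k; have [g2 g2E] := dv k.+1.
  exists (g1 - g2 * a); rewrite mulrBr mulrA -g1E -g2E mulrBl uk.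
  by rewrite opprB addrA subrK.
have gj : t ^+ j * f * g = t * c * (t ^+ j * f * g).
  rewrite -[in LHS]tjf !mulrA; congr (_ * _ * _).
  by rewrite exprS -!mulrA; congr (_ * _); apply/commr_sym/commrX/commr_sym.
have gjE : t ^+ j * f * g = t ^+ (j + k) * (1 - t * a).
  by rewrite -mulrA -gE !mulrBr mulr1 -exprD !mulrA -exprSr -exprD addnS.
rewrite gjE in gj.
have tm n : GRing.comm (t ^+ n) c by apply/commr_sym/commrX/commr_sym.
apply: (@drazin_comm_criterion _ (a + c * (1 - t * a)) (j + k)).
  apply: commrD => //; apply: commrM => //; apply: commrB; first exact: commr1.
  by apply: commrM.
rewrite mulrDr mulrA exprSr -(mulrA _ t c) !mulrA.
rewrite -(mulrA (t ^+ _) t c) (_ : t ^+ (j + k) * (t * c) = t * c * t ^+ (j + k)).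
  rewrite -(mulrA _ (t ^+ _)) -gj mulrBr mulr1 !mulrA -exprSr.
  by rewrite addrC subrK.
by rewrite mulrA -exprSr exprS -!mulrA tm.
Qed.

End DrazinRing.

(** * Neumann series and the open mapping theorem *)

Section Subspace.
Variables (K : numFieldType) (X : lmodType K).
Implicit Types (x y : X) (V : set X).

Definition is_subspace V := V 0 /\ forall (a : K) x y, V x -> V y -> V (a *: x + y).

Lemma subspaceD V x y : is_subspace V -> V x -> V y -> V (x + y).
Proof. by move=> [_ Vl] Vx Vy; rewrite -[x]scale1r; apply: Vl. Qed.

Lemma subspaceZ V (a : K) x : is_subspace V -> V x -> V (a *: x).
Proof. by move=> [V0 Vl] Vx; rewrite -[_ *: _]addr0; apply: Vl. Qed.

Lemma subspaceN V x : is_subspace V -> V x -> V (- x).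
Proof. by move=> sV Vx; rewrite -scaleN1r; apply: subspaceZ. Qed.

Lemma subspaceB V x y : is_subspace V -> V x -> V y -> V (x - y).
Proof. by move=> sV Vx Vy; apply: subspaceD => //; apply: subspaceN. Qed.

Lemma subspace_sum V n (u : 'I_n -> X) :
  is_subspace V -> (forall i, V (u i)) -> V (\sum_i u i).
Proof. by move=> sV Vu; apply: big_ind => //; [case: sV|move=> *; exact: subspaceD]. Qed.

End Subspace.

(** * Neumann series, Baire category and open mapping on closed subspaces *)

Section BanachSpace.
Variables (R : realType) (X : completeNormedModType R[i]).
Implicit Types (x y : X) (V W : set X).

(** Serves as uniqueness of limits: an equality is proved by bounding the difference of its sides at
    geometric rate. *)
Lemma nrm_half_exp_eq0 x (c : R) : (forall n, nrm x <= c * 2^-1 ^+ n) -> x = 0.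
Proof.
move=> xc; apply: nrm_eq0; apply: le_anti; rewrite nrm_ge0 andbT.
have c0 : 0 <= c by have := xc 0%N; rewrite expr0 mulr1; apply/le_trans/nrm_ge0.
apply/ler_addgt0Pr => e e0; rewrite add0r.
have [|n ne] := @half_exp_small R (e / (c + 1)); first by rewrite divr_gt0//; lra.
rewrite (le_trans (xc n))// ltW//.
move: ne; rewrite ltr_pdivlMr; last lra.
apply: le_lt_trans; rewrite mulrC ler_wpM2l ?exprn_ge0//; lra.
Qed.

Lemma bop_exp_bound (a : bop X) (c : R) : 0 <= c ->
  (forall x, nrm (a x) <= c * nrm x) ->
  forall n x, nrm ((a ^+ n) x) <= c ^+ n * nrm x.
Proof.
move=> c0 ac n x; elim: n => [|n IH]; first by rewrite expr0 mul1r.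
by rewrite !exprS bopM (le_trans (ac _))// -mulrA ler_wpM2l.
Qed.

(** The sum of the powers [a ^+ k] is built pointwise. The rate in the last clause is uniform on
    bounded sets, which the Laurent expansion at a pole requires. *)
Lemma neumann (a : bop X) : (forall x, nrm (a x) <= 2^-1 * nrm x) ->
  exists s : bop X, [/\ s * (1 - a) = 1, (1 - a) * s = 1 &
    forall n x, nrm (s x - (\sum_(k < n) a ^+ k) x) <= nrm x * 2 * 2^-1 ^+ n].
Proof.
move=> ha; have h0 : (0 : R) <= 2^-1 by lra.
have han := bop_exp_bound h0 ha.
have /choice[s sP] : forall x, exists y : X, forall n,
    nrm (y - (\sum_(k < n) a ^+ k) x) <= nrm x * 2 * 2^-1 ^+ n.
  move=> x; have [|y yP] := @nrm_geometric_cvg _ X (fun n => (a ^+ n) x) (nrm x).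
    by move=> n; rewrite mulrC; exact: han.
  exists y => n; rewrite (bop_sum _ (fun k => a ^+ k)). exact: yP.
have sl : s \in @bop_pred R X.
  apply/asboolP; split; last first.
    exists 2 => x; have := sP x 0%N.
    by rewrite big_ord0 bop0 subr0 expr0 mulr1 mulrC.
  move=> al x y; apply/eqP; rewrite -subr_eq0; apply/eqP.
  apply: (@nrm_half_exp_eq0 _ (nrm (al *: x + y) * 2 + (cnrm al * (nrm x * 2) + nrm y * 2))) => n.
  set S := \sum_(k < n) a ^+ k.
  (* Linearity passes to the limit by inserting the partial sum [S], which is linear. *)
  have -> : s (al *: x + y) - (al *: s x + s y) =
     (s (al *: x + y) - S (al *: x + y)) + - (al *: (s x - S x) + (s y - S y)).
    rewrite [S (_ + _)]linearP scalerBr (addrACA (_ *: s x)) -opprD.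
    by rewrite opprB addrA subrK.
  rewrite (le_trans (nrmD _ _))// nrmN mulrDl; apply: lerD; first exact: sP.
  rewrite (le_trans (nrmD _ _))// mulrDl; apply: lerD; last exact: sP.
  by rewrite nrmZ -mulrA; apply: ler_wpM2l; [exact: cnrm_ge0|exact: sP].
have [c c0 cP] := bop_boundP (1 - a).
have San n : (1 - a) * (\sum_(k < n) a ^+ k) = 1 - a ^+ n.
  by rewrite -(opprB a) mulNr -subrX1 opprB.
exists (Bop sl); split => //; apply: bopP => x; apply/eqP; rewrite -subr_eq0; apply/eqP.
- apply: (@nrm_half_exp_eq0 _ (nrm ((1 - a) x) * 2 + nrm x)) => n.
  have Sn : (\sum_(k < n) a ^+ k) * (1 - a) = 1 - a ^+ n.
    by rewrite -San; apply/commr_sym/commr_sum => i _;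
      apply/commrX/commr_sym/commrB => //; exact: commr1.
  rewrite (le_trans (nrmB_trans (((\sum_(k < n) a ^+ k) * (1 - a)) x) _ _))//.
  rewrite Sn mulrDl; apply: lerD; first by rewrite -Sn; exact: sP.
  by rewrite bopB bop1 addrAC subrr sub0r nrmN mulrC han.
- apply: (@nrm_half_exp_eq0 _ (c * (nrm x * 2) + nrm x)) => n.
  have Sn : (1 - a) * (\sum_(k < n) a ^+ k) = 1 - a ^+ n by [].
  rewrite (le_trans (nrmB_trans (((1 - a) * \sum_(k < n) a ^+ k) x) _ _))//.
  rewrite !bopM mulrDl; apply: lerD.
    rewrite -linearB (le_trans (cP _))// -mulrA ler_wpM2l// ltW//.
  by rewrite -bopM Sn bopB bop1 addrAC subrr sub0r nrmN mulrC han.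
Qed.

(* Nested balls [s n] in [W], the [n]-th one avoiding [C n]. *)
Lemma baire_cover W (C : nat -> set X) : closed W -> W !=set0 ->
  W `<=` \bigcup_n C n ->
  exists n w (r : R), [/\ W w, 0 < r & forall y, W y -> nrm (y - w) < r ->
    forall e : R, 0 < e -> exists2 c, C n c & nrm (c - y) < e].
Proof.
move=> cW [w0 Ww0] WC; apply: contrapT => NC.
have step (p : nat * (X * R)) : exists q : X * R, W p.2.1 -> 0 < p.2.2 ->
  [/\ W q.1, 0 < q.2, q.2 <= p.2.2 / 2, nrm (q.1 - p.2.1) <= p.2.2 - q.2 &
      forall c, C p.1 c -> q.2 < nrm (c - q.1)].
  case: p => n [w r] /=.
  have [[Ww r0]|H] := pselect (W w /\ 0 < r); last by exists (w, r) => ? ?; case: H.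
  have [y [Wy yw [e e0 ye]]] : exists y, [/\ W y, nrm (y - w) < r &
      exists2 e : R, 0 < e & forall c, C n c -> e <= nrm (c - y)].
    apply: contrapT => H; apply: NC; exists n, w, r; split => // y Wy yw e e0.
    apply: contrapT => H2; apply: H; exists y; split => //; exists e => // c Cc.
    by rewrite leNgt; apply/negP => cy; apply: H2; exists c.
  (* The three bounds keep the new ball away from [C n], halve the radius, and keep the new ball
     inside the old one. *)
  pose m := Num.min (e / 2) (Num.min (r / 2) (r - nrm (y - w))).
  have m0 : 0 < m by rewrite !lt_min !divr_gt0//= subr_gt0.
  have [m1 m2 m3] : [/\ m <= e / 2, m <= r / 2 & m <= r - nrm (y - w)].
    by split; rewrite /m !ge_min lexx ?orbT.
  exists (y, m) => _ _ /=; split => //; first by lra.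
  by move=> c /ye; lra.
have {step} [f fP] := choice step.
pose fix s n := if n is n'.+1 then f (n', s n') else (w0, 1).
have sW n : W (s n).1 /\ 0 < (s n).2.
  elim: n => [|n [IH1 IH2]]; first by split.
  by have [] := fP (n, s n) IH1 IH2.
have sP n := fP (n, s n) (sW n).1 (sW n).2.
have s2 n : (s n).2 <= 2^-1 ^+ n.
  elim: n => [|n IH]; first by rewrite expr0.
  have [_ _ + _ _] := sP n; rewrite -/(s n.+1) exprS /=; lra.
have sd n m : nrm ((s (n + m)%N).1 - (s n).1) <= (s n).2 - (s (n + m)%N).2.
  elim: m => [|m IH]; first by rewrite addn0 !subrr nrm0.
  have [_ _ _ + _] := sP (n + m)%N; rewrite -/(s (n + m).+1) addnS /=.
  have := nrmB_trans (s (n + m)%N).1 (s (n + m).+1).1 (s n).1; lra.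
have [|l lP] := @nrm_geometric_cvg _ X (fun n => (s n.+1).1 - (s n).1) 1.
  move=> n; have := sd n 1%N; rewrite addn1 mul1r => h.
  have := s2 n; have := (sW n.+1).2; lra.
have {}lP n : nrm ((l + w0) - (s n).1) <= 2 * 2^-1 ^+ n.
  have := lP n; rewrite mul1r.
  rewrite -(big_mkord xpredT (fun k => (s k.+1).1 - (s k).1)).
  by rewrite telescope_sumr//= opprB addrA.
have Wl : W (l + w0).
  apply: (closed_nrmP cW) => e e0; have [|n ne] := @half_exp_small R (e / 2).
    by rewrite divr_gt0.
  exists (s n).1; first by case: (sW n).
  by rewrite (le_lt_trans (lP n))//; lra.
have ls n : nrm ((l + w0) - (s n).1) <= (s n).2.
  apply/ler_addgt0Pr => e e0; have [|m me] := @half_exp_small R (e / 2).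
    by rewrite divr_gt0.
  have := lP (n + m)%N; have := sd n m.
  have := nrmB_trans (s (n + m)%N).1 (l + w0) (s n).1.
  have := (sW (n + m)%N).2.
  have : 2^-1 ^+ (n + m) <= 2^-1 ^+ m :> R.
    by rewrite exprD ler_piMl ?exprn_ge0// exprn_ile1//; lra.
  lra.
have [n _ /= Cn] := WC _ Wl; have [_ _ _ _ /(_ _ Cn)] := sP n.
by rewrite ltNge; have /= -> := ls n.+1.
Qed.

(** By Baire, the image of some ball of [V] is dense in a ball of [t V]. By scaling, each [y] in
    [t V] is then within half its norm of some [t x] with [x] in [V] of controlled norm; summing
    successive corrections gives an exact preimage. *)
Lemma open_mapping (t : bop X) V : is_subspace V -> closed V -> closed (t @` V) ->
  exists2 c : R, 0 < c &
    forall y, (t @` V) y -> exists x, [/\ V x, t x = y & nrm x <= c * nrm y].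
Proof.
move=> sV cV ctV.
have [||n [w [r [[u0 Vu0 tu0] r0 rP]]]] :=
    @baire_cover (t @` V) (fun n => t @` (V `&` [set x | nrm x <= n%:R])) ctV.
- by exists (t 0), 0 => //; case: sV.
- move=> _ [x Vx <-]; exists (Num.truncn (nrm x)).+1 => //; exists x => //; split => //=.
  by rewrite ltW// truncnS_gt.
have ap y (e : R) : (t @` V) y -> 0 < e -> exists x,
   [/\ V x, nrm x <= 4 * n%:R / r * nrm y & nrm (y - t x) <= e].
  move=> [v Vv tv] e0; have [y0|y0] := eqVneq y 0.
    exists 0; split; first by case: sV.
      by rewrite y0 !nrm0 mulr0.
    by rewrite linear0 y0 subrr nrm0 ltW.
  (* This scaling puts [D *: y + w] in the ball about [w]. Approximate it and [w] by images of [u1]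
     and [u2], of norm at most [n]: the difference approximates [D *: y], and dividing by [d] yields
     the factor [4 * n%:R / r]. *)
  have ny := nrm_gt0 y0; pose d := r / (2 * nrm y).
  have d0 : 0 < d by rewrite divr_gt0// mulr_gt0.
  pose D := real_complex R d.
  have D0 : D != 0 by rewrite -[0]/(real_complex R 0) (inj_eq (@complexI R)) gt_eqF.
  have cD : cnrm D = d by rewrite cnrm_real// ltW.
  have cDV : cnrm D^-1 = d^-1.
    by rewrite -fmorphV cnrm_real// invr_ge0 ltW.
  have e'0 : 0 < d * e / 2 by rewrite divr_gt0// mulr_gt0.
  have [||_ [u1 [Vu1 nu1] <-] u1y] := rP (D *: y + w) _ _ _ e'0.
  - exists (D *: v + u0); first by apply: subspaceD => //; apply: subspaceZ.
    by rewrite linearP/= tv tu0.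
  - rewrite addrK nrmZ cD /d (_ : _ * _ = r / 2); first by lra.
    by field; rewrite gt_eqF.
  have [||_ [u2 [Vu2 nu2] <-] u2y] := rP w _ _ _ e'0.
  - by exists u0.
  - by rewrite subrr nrm0.
  exists (D^-1 *: (u1 - u2)); split.
  - by apply: subspaceZ => //; exact: subspaceB.
  - rewrite nrmZ cDV.
    have -> : 4 * n%:R / r * nrm y = d^-1 * (n%:R + n%:R).
      by rewrite /d; field; rewrite !gt_eqF.
    apply: ler_wpM2l; first by rewrite invr_ge0 ltW.
    by rewrite (le_trans (nrmD _ _))// nrmN lerD.
  - rewrite linearZ/= -(ler_pM2l d0) -cD -nrmZ scalerBr scalerA mulfV// scale1r cD.
    have -> : D *: y - t (u1 - u2) = (D *: y + w - t u1) + (t u2 - w).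
      rewrite linearB/= opprB (addrAC _ w) (addrACA (_ - t u1)) subrr addr0.
      by rewrite addrA addrAC.
    rewrite (le_trans (nrmD _ _))// nrm_distC; move: u1y u2y => /ltW + /ltW; lra.
have {}ap y : exists x, (t @` V) y ->
   [/\ V x, nrm x <= 4 * n%:R / r * nrm y & nrm (y - t x) <= 2^-1 * nrm y].
  have [tVy|] := pselect ((t @` V) y); last by exists 0.
  have [y0|y0] := eqVneq y 0.
    exists 0; split; first by case: sV.
      by rewrite y0 !nrm0 mulr0.
    by rewrite linear0 y0 subrr nrm0 mulr0.
  have [|x [Vx xy yx]] := ap _ (2^-1 * nrm y) tVy; last by exists x.
  by rewrite mulr_gt0 ?invr_gt0// nrm_gt0.
set C := 4 * n%:R / r in ap.
have C0 : 0 <= C by rewrite divr_ge0 ?mulr_ge0// ltW.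
clearbody C; have {ap} [g gP] := choice ap.
have tVs : is_subspace (t @` V).
  split; first by exists 0; [case: sV|rewrite linear0].
  move=> al _ _ [x Vx <-] [y Vy <-]; exists (al *: x + y); last by rewrite linearP.
  exact: sV.2.
exists (C * 2 + 1) => [|y tVy]; first by lra.
(* [z k] is what remains of [y] after [k] corrections. It halves each time, so the corrections
   [g (z k)] sum to a preimage of norm at most [C * 2 * nrm y]. *)
pose z k := iter k (fun y => y - t (g y)) y.
have tVz k : (t @` V) (z k).
  elim: k => [//|k IH]; have -> : z k.+1 = z k - t (g (z k)) by [].
  apply: subspaceB => //; exists (g (z k)) => //.
  by have [] := gP _ IH.
have nz k : nrm (z k) <= nrm y * 2^-1 ^+ k.
  elim: k => [|k IH]; first by rewrite expr0 mulr1.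
  have [_ _ /le_trans] := gP _ (tVz k); apply; rewrite exprS mulrCA.
  by apply: ler_wpM2l => //; lra.
have [|s sP] := @nrm_geometric_cvg _ X (fun k => g (z k)) (C * nrm y).
  move=> k; have [_ /le_trans + _] := gP _ (tVz k); apply.
  by rewrite -mulrA; apply: ler_wpM2l.
have zE k : z k = y - t (\sum_(i < k) g (z i)).
  elim: k => [|k IH]; first by rewrite big_ord0 linear0 subr0.
  by rewrite big_ord_recr/= linearD opprD addrA -IH.
exists s; split.
- apply: (closed_nrmP cV) => e e0.
  have [|k ke] := @half_exp_small R (e / (C * nrm y * 2 + 1)).
    by rewrite divr_gt0// ltr_wpDl// mulr_ge0// mulr_ge0// nrm_ge0.
  exists (\sum_(i < k) g (z i)).
    by apply: subspace_sum => // i; have [] := gP _ (tVz i).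
  rewrite (le_lt_trans (sP k))//.
  have K0 : 0 <= C * nrm y * 2 by rewrite mulr_ge0// mulr_ge0// nrm_ge0.
  move: ke; rewrite ltr_pdivlMr; last lra.
  apply: le_lt_trans; rewrite mulrC; apply: ler_wpM2l; last lra.
  by rewrite exprn_ge0//; lra.
- have [c c0 cP] := bop_boundP t.
  apply/eqP; rewrite -subr_eq0; apply/eqP.
  apply: (@nrm_half_exp_eq0 _ (c * (C * nrm y * 2) + nrm y)) => k.
  have -> : t s - y = t (s - \sum_(i < k) g (z i)) - z k.
    by rewrite zE linearB opprB addrA subrK.
  rewrite (le_trans (nrmD _ _))// nrmN mulrDl; apply: lerD => //.
  rewrite (le_trans (cP _))// -mulrA; apply: ler_wpM2l (sP k); exact: ltW.
- have := sP 0%N; rewrite big_ord0 subr0 expr0 mulr1 => /le_trans; apply.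
  by have := nrm_ge0 y; lra.
Qed.

End BanachSpace.

(** * Finite dimension *)

Section FiniteDimension.
Variables (K : numFieldType) (X : lmodType K).
Implicit Types (N M V : set X).

(** For a subspace [V], this is [V] plus the linear span of [e]; no independence is asked, so
    generating families can be moved around before a basis is extracted. *)
Definition span_mod V k (e : 'I_k -> X) : set X :=
  [set x | exists a : 'I_k -> K, V (x - \sum_i a i *: e i)].

Lemma span_mod_subspace V k (e : 'I_k -> X) : is_subspace V -> is_subspace (span_mod V e).
Proof.
move=> sV; split.
  exists (fun=> 0); rewrite big1 ?subr0; first by case: sV.
  by move=> i _; rewrite scale0r.
move=> al x y [a Va] [b Vb]; exists (fun i => al * a i + b i).
have -> : al *: x + y - \sum_i (al * a i + b i) *: e i =
    al *: (x - \sum_i a i *: e i) + (y - \sum_i b i *: e i).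
  rewrite scalerBr addrACA -opprD; congr (_ - _); rewrite scaler_sumr -big_split/=.
  by apply: eq_bigr => i _; rewrite scalerDl scalerA.
exact: sV.2.
Qed.

Lemma span_modS V k (e : 'I_k.+1 -> X) :
  span_mod V e = [set x | exists a : K, span_mod V (e \o lift ord0) (x - a *: e ord0)].
Proof.
apply/seteqP; split=> x /=.
  move=> [a Va]; exists (a ord0), (a \o lift ord0).
  by move: Va; rewrite big_ord_recl opprD addrA.
move=> [s [a Va]]; exists (fun i => oapp a s (unlift ord0 i)).
rewrite big_ord_recl unlift_none/= opprD addrA.
under eq_bigr do rewrite liftK/=.
exact: Va.
Qed.

(** Basis extraction: a nontrivial relation modulo [N] allows one vector to be dropped, and when
    there is no relation the coordinates are unique. *)
Lemma findim_span N M k (e : 'I_k -> X) : is_subspace N ->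
  (forall i, M (e i)) -> M `<=` span_mod N e -> findim N M.
Proof.
move=> sN; elim: k e => [|k IH] e Me MN.
  exists 0%N, e; split=> // x /MN[a Na]; exists 0; split => [|b _].
    by move: Na; rewrite !big_ord0.
  by apply/rowP => -[].
have [[c [Nc [i0 ci0]]]|Nind] :=
    pselect (exists c : 'I_k.+1 -> K, N (\sum_i c i *: e i) /\ exists i, c i != 0).
  apply: (IH (e \o lift i0)) => [i|x /MN[a Na]]; first exact: Me.
  pose r := a i0 / c i0.
  exists (fun i => a (lift i0 i) - r * c (lift i0 i)).
  have -> : x - \sum_i (a (lift i0 i) - r * c (lift i0 i)) *: (e \o lift i0) i =
     (x - \sum_i a i *: e i) + r *: (\sum_i c i *: e i).
    rewrite -addrA; congr (_ + _); apply/eqP; rewrite eq_sym.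
    rewrite -(inj_eq oppr_inj) opprD !opprK; apply/eqP.
    rewrite scaler_sumr -sumrB (bigD1_ord i0)//= scalerA -scalerBl.
    rewrite /r divfK// subrr scale0r add0r; apply: eq_bigr => i _.
    by rewrite scalerA -scalerBl.
  by apply: subspaceD => //; exact: subspaceZ.
exists k.+1, e; split=> // x /MN[a Na]; exists (\row_i a i); split.
  by under eq_bigr do rewrite mxE.
move=> b Nb; apply/rowP => i; rewrite mxE.
apply/eqP; rewrite -subr_eq0; apply/eqP/eqP; apply: contrapT => /negP ab.
apply: Nind; exists (fun i => a i - b 0 i); split; last by exists i.
under eq_bigr do rewrite scalerBl.
rewrite sumrB (_ : _ - _ = (x - \sum_i b 0 i *: e i) - (x - \sum_i a i *: e i)).
  exact: subspaceB.
by rewrite opprB [RHS]addrC addrA subrK.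
Qed.

Lemma basis_mod_span N M k (e : 'I_k -> X) : basis_mod N M e -> M `<=` span_mod N e.
Proof. by move=> [_ Me] x /Me[a [Na _]]; exists (a 0). Qed.

(** When [M] lies in [N], every coordinate vector represents every element, so with at least one
    basis vector the zero row and the row of ones contradict uniqueness. *)
Lemma has_dim0 N M k : is_subspace N -> M `<=` N -> has_dim N M k -> k = 0%N.
Proof.
move=> sN MN [e [Me uM]]; case: k e Me uM => // k e Me uM; exfalso.
have [a [_ ua]] := uM _ (Me ord0).
have Ni (b : 'rV[K]_k.+1) : N (e ord0 - \sum_i b 0 i *: e i).
  apply: subspaceB => //; first exact: MN.
  by apply: subspace_sum => // i; apply: subspaceZ => //; exact: MN.
have := ua _ (Ni 0); rewrite (ua _ (Ni (const_mx 1))) => /rowP/(_ ord0)/eqP.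
by rewrite !mxE oner_eq0.
Qed.

Lemma has_dim_sub N M : is_subspace N -> M `<=` N -> has_dim N M 0.
Proof.
move=> sN MN; exists (fun=> 0); split => [[]//|x /MN Nx]; exists 0; split.
  by rewrite big_ord0 subr0.
by move=> b _; apply/rowP => -[].
Qed.

Lemma findim_sub N M : is_subspace N -> M `<=` N -> findim N M.
Proof. by move=> sN MN; exists 0%N; exact: has_dim_sub. Qed.

Lemma dimq_sub N M : is_subspace N -> M `<=` N -> dimq N M = 0%N.
Proof.
by move=> sN MN; rewrite /dimq; case: xgetP => // k _; exact: has_dim0.
Qed.

(** Finite dimensionality excludes the conventional value 0 of [dimq], so 0 is a genuine dimension
    here. *)
Lemma dimq_eq0 N M : findim N M -> dimq N M = 0%N -> M `<=` N.
Proof.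
move=> [k Nk]; rewrite /dimq; case: xgetP => [l -> + l0|/(_ k)//].
rewrite l0 => -[e [_ Me]] x /Me[a [+ _]].
by rewrite big_ord0 subr0.
Qed.

Lemma mx_dep m n (A : 'M[K]_(m, n)) : (n < m)%N -> exists2 u : 'rV_m, u != 0 & u *m A = 0.
Proof.
move=> nm; have : kermx A != 0.
  by rewrite kermx_eq0 /row_free neq_ltn (leq_ltn_trans (rank_leq_col A)).
by move=> /rowV0Pn[v /sub_kermxP vA v0]; exists v.
Qed.

Lemma row_first_neq0 m (u : 'rV[K]_m) : u != 0 ->
  exists j : 'I_m, u 0 j != 0 /\ forall i : 'I_m, (i < j)%N -> u 0 i = 0.
Proof.
move=> u0; have [i ui] : exists i, u 0 i != 0.
  apply: contrapT => H; move/eqP: u0; apply; apply/rowP => i; rewrite mxE.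
  by apply: contrapT => /eqP ui; apply: H; exists i.
have [j uj jmin] := @arg_minnP _ i (fun i => u 0 i != 0) (@nat_of_ord m) ui.
exists j; split=> // l lj; apply/eqP; apply: contraTT lj => /jmin.
by rewrite -leqNgt.
Qed.

(** Otherwise there are vectors [v n] in [D (s n)] but not in [D (s n.+1)] for all [n]. In dimension
    [k], [k.+1] of them are dependent; solving for the first one with nonzero coefficient puts it in
    the next space of the chain. *)
Lemma findim_chain_stable (D : nat -> set X) : (forall n, is_subspace (D n)) ->
  (forall m n, (m <= n)%N -> D n `<=` D m) -> findim [set 0] (D 0%N) ->
  exists m, forall n, (m <= n)%N -> D m `<=` D n.
Proof.
move=> sD dD [k [e [De uD]]]; apply: contrapT => H.
have /choice[f fP] m : exists p : nat * X, [/\ (m <= p.1)%N, D m p.2 & ~ D p.1 p.2].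
  apply: contrapT => H1; apply: H; exists m => n mn x Dx.
  by apply: contrapT => nDx; apply: H1; exists (n, x).
pose s n := iter n (fun m => (f m).1) 0%N.
have smono i j : (i <= j)%N -> (s i <= s j)%N.
  move=> ij; rewrite -(subnKC ij); elim: (j - i)%N => [|l IH]; first by rewrite addn0.
  by rewrite addnS (leq_trans IH)//; have [] := fP (s (i + l)%N).
pose v n := (f (s n)).2.
have vD n : D (s n) (v n) by have [] := fP (s n).
have nvD n : ~ D (s n.+1) (v n) by have [] := fP (s n).
have /choice[a aP] (n : nat) : exists a : 'rV[K]_k, v n = \sum_i a 0 i *: e i.
  have /uD[a [Na _]] : D 0%N (v n) by apply: dD (vD n).
  by exists a; apply/eqP; rewrite -subr_eq0; apply/eqP.
have [u u0 uA] := @mx_dep k.+1 k (\matrix_i a i) (ltnSn k).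
have uv : \sum_(i < k.+1) u 0 i *: v i = 0.
  under eq_bigr do rewrite aP scaler_sumr.
  rewrite exchange_big/= big1// => j _.
  under eq_bigr do rewrite scalerA.
  rewrite -scaler_suml; have /rowP/(_ j) := uA; rewrite !mxE => uAj.
  rewrite (_ : (\sum_i _ = 0)) ?scale0r// -[RHS]uAj.
  by apply: eq_bigr => i _; rewrite !mxE.
have [j [uj umin]] := row_first_neq0 u0.
apply: (nvD j); rewrite -[v j]scale1r -(mulVf uj) -scalerA.
apply: subspaceZ => //.
have -> : u 0 j *: v j = - \sum_(i < k.+1 | i != j) u 0 i *: v i.
  by apply/eqP; rewrite -addr_eq0; move: uv; rewrite (bigD1 j)//= => ->.
apply: subspaceN => //; apply: big_ind => [||i ij]; [by case: (sD (s j.+1))| |].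
  by move=> x y; apply: subspaceD.
have [lij|lji] := ltnP i j; first by rewrite umin// scale0r; case: (sD (s j.+1)).
apply: subspaceZ => //; apply: dD (vD i); apply: smono.
by rewrite ltn_neqAle lji andbT eq_sym.
Qed.

(** The range of [F] is invariant under [T] and finite-dimensional, so some nonzero polynomial in
    [T] vanishes on it. Dividing by its lowest nonzero coefficient expresses the power [j] by higher
    powers. *)
Lemma finite_rank_recurrence (T F : {linear X -> X}) : findim [set 0] (range F) ->
  T \o F =1 F \o T -> exists j n (c : nat -> K), forall x,
    iter j T (F x) = \sum_(i < n) c i *: iter (j + i).+1 T (F x).
Proof.
move=> [k [e [We uW]]] TF.
have itF i x : iter i T (F x) = F (iter i T x).
  by elim: i => //= i ->; exact: TF.
have coord w : range F w -> exists a : 'rV[K]_k, w = \sum_i a 0 i *: e i.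
  move=> /uW[a [Na _]]; exists a.
  by apply/eqP; rewrite -subr_eq0; apply/eqP.
have /choice[a aP] (p : (nat * 'I_k)%type) : exists a : 'rV[K]_k,
    iter p.1 T (e p.2) = \sum_i a 0 i *: e i.
  apply: coord; case: (We p.2) => x _ <-; rewrite itF.
  by exists (iter p.1 T x).
(* Row [i] flattens the coordinates of the [i]-th iterate of [T] on the basis; with one row more
   than columns, the rows are dependent. *)
pose A : 'M[K]_((k * k).+1, (k * k)%N) :=
  \matrix_(i < (k * k).+1) mxvec (\matrix_(r, l) a (nat_of_ord i, r) 0 l).
have [u u0 uA] := mx_dep A (leqnn _).
have itsum i (b : 'I_k -> K) :
    iter i T (\sum_r b r *: e r) = \sum_r b r *: iter i T (e r).
  elim: i => [//|i /= ->]; rewrite linear_sum.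
  by apply: eq_bigr => r _; rewrite linearZ.
have ue r : \sum_(i < (k * k).+1) u 0 i *: iter i T (e r) = 0.
  under eq_bigr do rewrite (aP (_, _)) scaler_sumr.
  rewrite exchange_big/= big1// => l _.
  under eq_bigr do rewrite scalerA.
  rewrite -scaler_suml; have /rowP/(_ (mxvec_index r l)) := uA; rewrite !mxE => uAj.
  rewrite (_ : (\sum_i _ = 0)) ?scale0r// -[RHS]uAj.
  by apply: eq_bigr => i _; rewrite !mxE mxvecE mxE.
have uw w : range F w -> \sum_(i < (k * k).+1) u 0 i *: iter i T w = 0.
  move=> /coord[b ->]; under eq_bigr do rewrite itsum scaler_sumr.
  rewrite exchange_big/= big1// => r _.
  under eq_bigr do rewrite scalerA mulrC -scalerA.
  by rewrite -scaler_sumr ue scaler0.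
have [j [uj umin]] := row_first_neq0 u0.
(* [un] extends the coefficients to all naturals, so that the sum can be cut after [j] and reindexed
   from [j.+1]. *)
pose m := (k * k)%N; pose un i := u 0 (inord i : 'I_m.+1).
exists j, (m.+1 - j.+1)%N, (fun i => - un (i + j.+1)%N / u 0 j) => x.
have := uw (F x); rewrite (eq_bigr (fun i : 'I_m.+1 => un i *: iter i T (F x))); last first.
  by move=> i _; rewrite /un inord_val.
rewrite -(big_mkord xpredT (fun i => un i *: iter i T (F x))).
have jm : (j < m.+1)%N by [].
rewrite (@big_cat_nat _ _ _ j.+1)//= big_nat_recr//= big1_seq => [|i]; last first.
  rewrite mem_index_iota => /= ij; rewrite /un umin ?scale0r// inordK//.
  by rewrite (ltn_trans ij).
rewrite add0r {1}/un inord_val => /(_ (imageT _ _))/eqP.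
rewrite addr_eq0 => /eqP ujx.
rewrite -[LHS]scale1r -(mulVf uj) -scalerA ujx -[j.+1]add0n big_addn.
rewrite big_mkord scalerN scaler_sumr -sumrN; apply: eq_bigr => i _.
by rewrite scalerA mulrC mulNr scaleNr (addnS i j) (addnC i j).
Qed.

End FiniteDimension.

(** * Closed subspaces and power series *)

Section ComplexCompleteness.
Variable R : realType.

(** The sequence [u n - d n] is nondecreasing, [u n + d n] is nonincreasing, and the limit they
    enclose is the supremum of the former. *)
Lemma real_geometric_cvg (u : nat -> R) (c : R) :
  (forall n, `|u n.+1 - u n| <= c * 2^-1 ^+ n) ->
  exists l, forall n, `|u n - l| <= 2 * c * 2^-1 ^+ n.
Proof.
move=> uc; pose d n := 2 * c * 2^-1 ^+ n.
have dS n : d n.+1 = d n - c * 2^-1 ^+ n by rewrite /d exprS; lra.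
have lo m n : (m <= n)%N -> u m - d m <= u n - d n.
  move=> mn; rewrite -(subnKC mn); elim: (n - m)%N => [|k IH]; first by rewrite addn0.
  rewrite addnS (le_trans IH)// dS; have := uc (m + k)%N; rewrite ler_norml; lra.
have hi m n : (m <= n)%N -> u n + d n <= u m + d m.
  move=> mn; rewrite -(subnKC mn); elim: (n - m)%N => [|k IH]; first by rewrite addn0.
  rewrite addnS (le_trans _ IH)// dS; have := uc (m + k)%N; rewrite ler_norml; lra.
have d0 n : 0 <= d n.
  rewrite /d -mulrA mulr_ge0// (le_trans _ (uc n))//.
have lohi m n : u m - d m <= u n + d n.
  have := lo m (maxn m n) (leq_maxl _ _); have := hi n (maxn m n) (leq_maxr _ _).
  by have := d0 (maxn m n); lra.
pose A := range (fun n => u n - d n).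
have Aub n : ubound A (u n + d n) by move=> _ [m _ <-]; exact: lohi.
have A0 : A !=set0 by exists (u 0%N - d 0%N), 0%N.
exists (sup A) => n; rewrite -/(d n) ler_norml.
have h1 : sup A <= u n + d n by apply: ge_sup.
have h2 : u n - d n <= sup A.
  by apply: ub_le_sup; [exists (u 0%N + d 0%N); exact: Aub|exists n].
lra.
Qed.

Lemma complex_geometric_cvg (u : nat -> R[i]) (c : R) :
  (forall n, cnrm (u n.+1 - u n) <= c * 2^-1 ^+ n) ->
  exists l, forall n, cnrm (u n - l) <= 4 * c * 2^-1 ^+ n.
Proof.
move=> uc.
have ReN (z : R[i]) : `|complex.Re z| <= cnrm z.
  by rewrite -lecR -cnrmE normc_ge_Re.
have cR (r : R) : `|real_complex R r| = real_complex R `|r|.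
  by rewrite normc_def/= expr0n/= addr0 sqrtr_sqr.
have ci : `|'i%C : R[i]| = 1.
  by rewrite normc_def/= expr0n/= expr1n add0r sqrtr1.
have ImN (z : R[i]) : `|complex.Im z| <= cnrm z.
  by rewrite -normrN -ReiNIm (le_trans (ReN _))// /cnrm normrM ci mulr1.
have Rec n : `|complex.Re (u n.+1) - complex.Re (u n)| <= c * 2^-1 ^+ n.
  by rewrite (le_trans _ (uc n))// (le_trans _ (ReN _))// raddfB.
have Imc n : `|complex.Im (u n.+1) - complex.Im (u n)| <= c * 2^-1 ^+ n.
  by rewrite (le_trans _ (uc n))// (le_trans _ (ImN _))// raddfB.
have [x xP] := real_geometric_cvg Rec.
have [y yP] := real_geometric_cvg Imc.
exists (x +i* y)%C => n; set z := u n - _.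
have : cnrm z <= `|complex.Re z| + `|complex.Im z|.
  rewrite -lecR -cnrmE {1}(complexE z) (le_trans (ler_normD _ _))//.
  by rewrite normrM ci mul1r !cR rmorphD.
move/le_trans; apply; rewrite /z !raddfB/=.
have := lerD (xP n) (yP n); lra.
Qed.

End ComplexCompleteness.

(** * Finite extensions of closed subspaces; uniqueness of power series coefficients *)

Section SpanClosed.
Variables (R : realType) (X : completeNormedModType R[i]).
Implicit Types (V : set X).

(** If [e] is not in [V], it has positive distance [d] from [V], which bounds the coefficient of [e]
    by the norm of the vector divided by [d]. The coefficients along a convergent sequence therefore
    converge too. *)
Lemma closed_add_line V (e : X) : is_subspace V -> closed V ->
  closed [set x | exists a : R[i], V (x - a *: e)].
Proof.
move=> sV cV x /closure_nrmP xV.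
have [Ve|nVe] := pselect (V e).
  exists 0; rewrite scale0r subr0; apply: (closed_nrmP cV) => ep /xV[y [a Va] xy].
  exists y => //; rewrite -(subrK (a *: e) y); apply: subspaceD => //.
  exact: subspaceZ.
have [d d0 dV] : exists2 d : R, 0 < d & forall v, V v -> d <= nrm (e - v).
  apply: contrapT => H; apply: nVe; apply: (closed_nrmP cV) => d d0.
  apply: contrapT => H2; apply: H; exists d => // v Vv.
  by rewrite leNgt; apply/negP => ev; apply: H2; exists v.
have dVa v a : V v -> cnrm a <= nrm (v + a *: e) / d.
  move=> Vv; have [->|a0] := eqVneq a 0.
    by rewrite {1}/cnrm normr0 divr_ge0 ?nrm_ge0// ltW.
  rewrite ler_pdivlMr// (_ : v + _ = a *: (e - - a^-1 *: v)).
    rewrite nrmZ; apply: ler_wpM2l; first exact: cnrm_ge0.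
    by apply: dV; apply: subspaceZ.
  by rewrite scaleNr opprK scalerDr scalerA mulfV// scale1r addrC.
have h0 n : (0 : R) < 2^-1 ^+ n by apply: exprn_gt0; lra.
have /choice[f fP] n : exists p : X * R[i],
    V (p.1 - p.2 *: e) /\ nrm (x - p.1) < 2^-1 ^+ n.
  by have [y [a Va] xy] := xV _ (h0 n); exists (y, a).
have [|a aP] := @complex_geometric_cvg R (fun n => (f n).2) (2 / d).
  move=> n; have [V1 x1] := fP n; have [V2 x2] := fP n.+1.
  have := dVa _ ((f n.+1).2 - (f n).2) (subspaceB sV V2 V1).
  rewrite scalerBl opprB addrAC !subrKA => /le_trans; apply.
  rewrite -mulrAC ler_wpM2r ?invr_ge0 ?(ltW d0)//.
  have := nrmB_trans x (f n.+1).1 (f n).1; rewrite (nrm_distC _ x).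
  by move: x1 x2 (h0 n); rewrite exprS; lra.
exists a; apply: (closed_nrmP cV) => ep ep0.
pose M := 1 + 4 * (2 / d) * nrm e.
have M0 : 0 < M.
  by rewrite ltr_pwDl// mulr_ge0 ?nrm_ge0// mulr_ge0// divr_ge0// ltW.
have [n nM] := half_exp_small (divr_gt0 ep0 M0).
have [V1 x1] := fP n.
exists ((f n).1 - (f n).2 *: e) => //.
have -> : x - a *: e - ((f n).1 - (f n).2 *: e) = (x - (f n).1) + ((f n).2 - a) *: e.
  rewrite opprB scalerBl (addrC (_ *: e)) addrACA; congr (_ + _); exact: addrC.
rewrite (le_lt_trans (nrmD _ _))// nrmZ.
have := aP n; move: nM; rewrite ltr_pdivlMr//.
move=> nM /(ler_wpM2r (nrm_ge0 e)) h; move: nM; rewrite /M.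
move: h x1; set q := 2^-1 ^+ n; nra.
Qed.

Lemma closed_span_mod V k (e : 'I_k -> X) : is_subspace V -> closed V ->
  closed (span_mod V e).
Proof.
elim: k e => [|k IH] e sV cV.
  rewrite (_ : span_mod V e = V)//; apply/seteqP; split => x /=.
    by move=> [a]; rewrite big_ord0 subr0.
  by move=> Vx; exists (fun=> 0); rewrite big_ord0 subr0.
rewrite span_modS; apply: closed_add_line; last exact: IH.
exact: span_mod_subspace.
Qed.

(* At the first nonzero [b m], compare the term of rank [m] with the geometric
   tail along the sequence [w = (rho / 2) * 2^-i]. *)
Lemma power_series_eq0 (b : nat -> X) (rho : R) : 0 < rho ->
  (forall w : R[i], 0 < cnrm w < rho -> forall e : R, 0 < e ->
    exists N, forall n, (N <= n)%N -> nrm (\sum_(k < n) w ^+ k *: b k) < e) ->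
  forall m, b m = 0.
Proof.
move=> rho0 bs m; elim/ltn_ind: m => m IH.
pose r := rho / 2; have r0 : 0 < r by rewrite divr_gt0.
have cr (x : R) : 0 < x -> cnrm (real_complex R x) = x by move=> /ltW/cnrm_real.
have [K K0 bK] : exists2 K : R, 0 <= K & forall n, r ^+ n * nrm (b n) <= K.
  have [|N NP] := bs (real_complex R r) _ 1 ltr01.
    by rewrite cr// r0/= /r; lra.
  have sum0 : 0 <= \sum_(k < N) r ^+ k * nrm (b k).
    by apply: sumr_ge0 => i _; rewrite mulr_ge0 ?nrm_ge0 ?exprn_ge0// ltW.
  (* From rank [N] on, a term is the difference of two partial sums of norm below 1; the earlier
     terms are covered by the sum. *)
  exists (2 + \sum_(k < N) r ^+ k * nrm (b k)) => [|n]; first by lra.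
  have [nN|Nn] := ltnP n N.
    rewrite (bigD1 (Ordinal nN))//= addrCA lerDl addr_ge0//.
    by apply: sumr_ge0 => i _; rewrite mulr_ge0 ?nrm_ge0 ?exprn_ge0// ltW.
  have := NP _ (leqW Nn); rewrite big_ord_recr/=.
  set S := \sum_(i < n) _ => h1; have h2 := NP _ Nn.
  have -> : r ^+ n * nrm (b n) = nrm ((S + real_complex R r ^+ n *: b n) - S).
    by rewrite addrAC subrr add0r nrmZ cnrmX cr.
  by have := nrmD (S + real_complex R r ^+ n *: b n) (- S); rewrite nrmN; lra.
have rb : nrm (b m) * r ^+ m = 0.
  have H (i : nat) : nrm (b m) * r ^+ m <= K * 2^-1 ^+ i.
    pose q : R := 2^-1 ^+ i.+1.
    have q0 : 0 < q by apply: exprn_gt0; lra.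
    have q2 : q <= 2^-1.
      by rewrite /q exprS ler_piMr ?exprn_ile1//; lra.
    have qn0 n : 0 < q ^+ n by rewrite exprn_gt0.
    pose w := real_complex R (r * q).
    have cw : cnrm w = r * q by rewrite cr// mulr_gt0.
    have wt n : nrm (w ^+ n *: b n) <= K * q ^+ n.
      rewrite nrmZ cnrmX cw exprMn mulrAC ler_pM2r//.
    have tail n : nrm (\sum_(k < m.+1 + n) w ^+ k *: b k - w ^+ m *: b m) <=
        2 * K * q ^+ m.+1 - 2 * K * q ^+ (m.+1 + n).
      elim: n => [|n IHn].
        rewrite addn0 big_ord_recr/= addrK big1 ?nrm0 ?subrr//.
        by move=> k _; rewrite IH ?scaler0.
      rewrite addnS big_ord_recr/= addrAC (le_trans (nrmD _ _))//.
      have := wt (m.+1 + n)%N; rewrite (exprS q (m.+1 + n)).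
      have := ler_wpM2l (mulr_ge0 K0 (ltW (qn0 (m.+1 + n)%N))) q2.
      by move: IHn; set Q := q ^+ (m.+1 + n); lra.
    suff: nrm (b m) * r ^+ m <= 2 * K * q.
      by rewrite /q exprS; lra.
    rewrite -(ler_pM2r (qn0 m)).
    have -> : nrm (b m) * r ^+ m * q ^+ m = nrm (w ^+ m *: b m).
      by rewrite nrmZ cnrmX cw (exprMn _ r q) -mulrA mulrC.
    have -> : 2 * K * q * q ^+ m = 2 * K * q ^+ m.+1 by rewrite exprS mulrA.
    apply/ler_addgt0Pr => e e0.
    have [|N NP] := bs w _ _ e0.
      by rewrite cw mulr_gt0//= /r; nra.
    have := NP _ (leq_addl m.+1 N); have := tail N.
    set S := \sum_(k < _) _.
    have := nrmD (S) (- (S - w ^+ m *: b m)); rewrite nrmN opprB addrC subrK.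
    have := qn0 (m.+1 + N)%N; nra.
  apply: le_anti; rewrite mulr_ge0 ?nrm_ge0 ?exprn_ge0//; last exact: ltW.
  rewrite andbT; apply/ler_addgt0Pr => e e0; rewrite add0r.
  have [|n ne] := @half_exp_small R (e / (K + 1)); first by rewrite divr_gt0//; lra.
  rewrite (le_trans (H n))// ltW//.
  move: ne; rewrite ltr_pdivlMr; last lra.
  apply: le_lt_trans; rewrite mulrC ler_wpM2l ?exprn_ge0//; lra.
apply: nrm_eq0; apply/eqP; move/eqP: rb; rewrite mulf_eq0 => /orP[//|].
by rewrite expf_eq0 (gt_eqF r0) andbF.
Qed.

End SpanClosed.

(** * B-Weyl and Drazin invertible operators *)

Section RangeIter.
Variables (R : realType) (X : completeNormedModType R[i]).
Variable t : bop X.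
Notation r := (range_iter t).

Lemma range_iterP n x : r n x <-> exists y, x = (t ^+ n) y.
Proof.
split=> [[y _ <-]|[y ->]]; first by exists y; rewrite bopX.
by exists y; rewrite // bopX.
Qed.

Lemma range_iter_exp n x : r n ((t ^+ n) x).
Proof. by apply/range_iterP; exists x. Qed.

Lemma range_iter_subspace n : is_subspace (r n).
Proof.
split=> [|a _ _ /range_iterP[x ->] /range_iterP[y ->]]; apply/range_iterP.
  by exists 0; rewrite linear0.
by exists (a *: x + y); rewrite linearP.
Qed.

Lemma range_iterD m n : r (n + m) = (t ^+ m) @` r n.
Proof.
apply/seteqP; split=> x.
  move=> /range_iterP[y ->]; rewrite addnC exprD bopM.
  by exists ((t ^+ n) y) => //; exact: range_iter_exp.
move=> [_ /range_iterP[y ->] <-]; rewrite -bopM -exprD addnC.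
exact: range_iter_exp.
Qed.

Lemma range_iterS n : r n.+1 = t @` r n.
Proof. by rewrite -addn1 range_iterD expr1. Qed.

Lemma range_iter_le m n : (m <= n)%N -> r n `<=` r m.
Proof.
move=> mn x /range_iterP[y ->]; rewrite -(subnKC mn) exprD bopM.
exact: range_iter_exp.
Qed.

Lemma range_iter_stable n m : r n `<=` t @` r n -> (n <= m)%N -> r m = r n.
Proof.
move=> rn nm; apply/seteqP; split; first exact: range_iter_le.
rewrite -(subnKC nm); elim: (m - n)%N => [|k IH]; first by rewrite addn0.
by rewrite addnS range_iterS => x /rn[y /IH ry <-]; exists y.
Qed.

Lemma null_on_subspace n : is_subspace (null_on (r n) t).
Proof.
have sr := range_iter_subspace n.
split=> [|a x y [rx /= tx] [ry /= ty]]; split=> /=.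
- by case: sr.
- by rewrite linear0.
- exact: sr.2.
- by rewrite linearP/= tx ty scaler0 addr0.
Qed.

Lemma set0_subspace : is_subspace [set (0 : X)].
Proof. by split=> // a x y /= -> ->; rewrite scaler0 addr0. Qed.

(** As soon as some stable [n] exists there is a least one, so [dis] does not take its default
    value. *)
Lemma dis_min n : stable_from t n -> stable_from t (dis t) /\ (dis t <= n)%N.
Proof.
move=> tn; rewrite /dis; case: xgetP => [d -> [td dmin]|H].
  by split=> //; exact: dmin.
have ex : exists m, `[< stable_from t m >] by exists n; apply/asboolP.
exfalso; apply: (H (ex_minn ex)); case: ex_minnP => m /asboolP tm mmin.
by split=> // l /asboolP/mmin.
Qed.

Lemma stable_from_null n x : stable_from t n -> r n x -> t x = 0 -> forall m, r m x.
Proof.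
move=> tn rx tx m; have [nm|/ltnW mn] := leqP n m.
  by have [] := tn m nm x _.
exact: range_iter_le rx.
Qed.

(** From rank [n] on, the intersections of [N(t)] with the ranges decrease inside a
    finite-dimensional space. *)
Lemma findim_null_stable n : findim [set 0] (null_on (r n) t) -> exists m, stable_from t m.
Proof.
move=> fn; have [|||m mP] := @findim_chain_stable _ X (fun j => null_on (r (n + j)) t).
- by move=> j; exact: null_on_subspace.
- by move=> i j ij x [rx tx]; split=> //; apply: range_iter_le rx; rewrite leq_add2l.
- by rewrite addn0.
exists (n + m)%N => j nmj x [rx [_ tx]]; split=> //.
have [|//] := mP (j - n)%N _ x (conj rx tx).
  by rewrite leq_subRL// (leq_trans (leq_addr _ _) nmj).
by rewrite subnKC// (leq_trans (leq_addr _ _) nmj).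
Qed.

Lemma range_exp_inj n j x : (forall y, r n y -> t y = 0 -> y = 0) ->
  r n x -> (t ^+ j) x = 0 -> x = 0.
Proof.
move=> tinj; elim: j => [//|j IH] rx; rewrite exprS bopM => tx.
apply: IH => //; apply: tinj tx; apply: (@range_iter_le _ (n + j)%N) (leq_addr _ _) _ _.
by rewrite range_iterD; exists x.
Qed.

Lemma closed_bop_ker (f : bop X) : closed [set x | f x = 0].
Proof.
move=> x /closure_nrmP xf; have [c c0 cf] := bop_boundP f.
apply: nrm_eq0; apply: le_anti; rewrite nrm_ge0 andbT.
apply/ler_addgt0Pr => e e0; rewrite add0r.
have [y /= fy xy] := xf _ (divr_gt0 e0 c0).
rewrite -[f x]subr0 -fy -linearB (le_trans (cf _))// ltW//.
by rewrite mulrC -ltr_pdivlMr.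
Qed.

(** On [R(t^k)], which is the kernel of [1 - t * a] and hence closed, [t] is bijective. The index is
    read at [d = dis t <= k], so bijectivity must be carried down to [R(t^d)]: injectivity by
    stability, surjectivity by applying [t ^+ (k - d)]. *)
Lemma drazin_Bweyl : drazin t -> Bweyl t.
Proof.
move=> [a [k ta]]; have [_ tkp _ pn] := drazin_idem ta.
case: ta => tka _ ta.
have tak n : GRing.comm (t ^+ n) a by apply/commr_sym/commrX/commr_sym.
have atk : a * t * t ^+ k = t ^+ k.
  by rewrite -mulrA -exprS exprSr mulrA -tak.
have inj x : r k x -> t x = 0 -> x = 0.
  move=> /range_iterP[y ->] tx.
  by rewrite -[LHS]/((t ^+ k) y) -atk -mulrA !bopM tx linear0.
have surj : r k `<=` t @` r k.
  move=> _ /range_iterP[y ->]; exists ((t ^+ k) (a y)); first exact: range_iter_exp.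
  by rewrite -!bopM -exprS exprSr -mulrA ta mulrA tka.
have cl : closed (r k).
  rewrite (_ : r k = [set x | (1 - t * a) x = 0]); first exact: closed_bop_ker.
  apply/seteqP; split=> x; rewrite /mkset.
    by move=> /range_iterP[y ->]; rewrite bopB bop1 -bopM ta atk subrr.
  rewrite bopB bop1 => /eqP; rewrite subr_eq0 => /eqP xE; apply/range_iterP.
  exists ((a ^+ k) x); rewrite -bopM {2}xE -bopM pn.
  exact: xE.
have st : stable_from t k.
  move=> m km x [rx [_ tx]]; rewrite (inj x rx tx); split.
    by case: (range_iter_subspace m).
  by split=> //=; rewrite linear0.
have sT n : is_subspace (t @` r n) by rewrite -range_iterS; exact: range_iter_subspace.
split.
  exists k; split => //; split.
  - by apply: findim_sub set0_subspace _ => x [rx tx]; exact: inj.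
  - exact: findim_sub.
  - by apply: closed_subspaceW; rewrite -range_iterS (range_iter_stable surj).
have [std dk] := dis_min st; set d := dis t in std dk.
have injd x : r d x -> t x = 0 -> x = 0.
  by move=> rx tx; apply: inj => //; exact: stable_from_null std _ _ _.
rewrite /Bindex /index_on -/d.
rewrite (dimq_sub set0_subspace) => [|x [rx tx]]; last exact: injd.
rewrite dimq_sub ?subrr// => x rx; rewrite -range_iterS.
(* [x] and some [z] in [R(t^(d+1))] have the same image under [t ^+ (k - d)], which is injective on
   [R(t^d)]; so [x = z]. *)
have [z rz zx] : exists2 z, r d.+1 z & (t ^+ (k - d)) z = (t ^+ (k - d)) x.
  have : r (d.+1 + (k - d)) ((t ^+ (k - d)) x).
    rewrite addSn subnKC// (range_iter_stable surj)//.
    by rewrite -{1}(subnKC dk) range_iterD; exists x.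
  by rewrite range_iterD => -[z]; exists z.
suff /eqP : x - z = 0 by rewrite subr_eq0 => /eqP ->.
apply: (range_exp_inj (j := k - d)) injd _ _.
  apply: subspaceB => //; first exact: range_iter_subspace.
  by apply: range_iter_le rz.
by rewrite linearB/= zx subrr.
Qed.

(* If [t u] is a limit of points of [t (R(t^n.+1))], the open mapping theorem
   puts [u] in the closure of [R(t^n.+1) + N(t)], which is closed since only
   finitely many dimensions of [N(t)] matter. *)
Lemma closed_range_iterS n k (e : 'I_k -> X) :
  (forall i, t (e i) = 0) -> null_on (r n) t `<=` span_mod [set 0] e ->
  closed (r n) -> closed (r n.+1) -> closed (r n.+2).
Proof.
move=> te Ne c0 c1; have sr := range_iter_subspace.
have := @open_mapping R X t (r n) (sr n) c0; rewrite -range_iterS => /(_ c1)[c cp omt].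
move=> x /closure_nrmP x2.
have rx : r n.+1 x.
  by apply: (closed_nrmP c1) => ep /x2[y ry xy]; exists y => //; exact: range_iter_le ry.
have [u ru tu] : (t @` r n) x by rewrite -range_iterS.
have [a ua] : span_mod (r n.+1) e u.
  apply: (closed_nrmP (closed_span_mod (sr _) c1)) => ep ep0.
  have [y] := x2 _ (divr_gt0 ep0 cp); rewrite range_iterS => -[z rz <-] xy.
  have [|w [rw tw wx]] := omt (x - t z).
    apply: subspaceB => //; rewrite range_iterS; exists z => //.
    exact: range_iter_le rz.
  have [|a na] := Ne (u - z - w).
    split; last by rewrite /= !linearB/= tu tw subrr.
    by do 2!apply: subspaceB => //; exact: range_iter_le rz.
  exists (u - w).
    exists a; rewrite (_ : u - w - _ = z)//; apply/eqP; rewrite -subr_eq0.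
    by rewrite addrAC (addrAC u) na.
  by rewrite opprB addrC subrK (le_lt_trans wx)// mulrC -ltr_pdivlMr.
rewrite range_iterS; exists (u - \sum_i a i *: e i) => //.
rewrite linearB/= tu linear_sum big1 ?subr0// => i _.
by rewrite linearZ/= te scaler0.
Qed.

End RangeIter.

(** * From B-Weyl to Drazin invertible *)

Section BWeylDrazin.
Variables (R : realType) (X : completeNormedModType R[i]).
Variable t : bop X.
Notation r := (range_iter t).

(* Otherwise [x0 + s] below is an eigenvector of [t] for some small [w]. *)
Lemma no_null_in_stable_range m (rho : R) : closed (r m) -> closed (r m.+1) ->
  stable_from t m -> 0 < rho ->
  (forall w : R[i], 0 < cnrm w < rho -> forall x, t x = w *: x -> x = 0) ->
  forall x, r m x -> t x = 0 -> x = 0.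
Proof.
move=> c0 c1 st rho0 tinj x0 rx0 tx0; apply: contrapT => /eqP x00.
have sr := range_iter_subspace t.
have := @open_mapping R X t (r m) (sr m) c0; rewrite -range_iterS => /(_ c1)[c cp omt].
have /choice[g gP] y : exists x, (forall j, r j y) ->
    [/\ forall j, r j x, t x = y & nrm x <= c * nrm y].
  have [ry|] := pselect (forall j, r j y); last by exists 0.
  have [x [rx tx xy]] := omt y (ry m.+1); exists x => _; split=> // j.
  (* The preimage [x] differs from a preimage [z] in a deep range by a null vector of [R(t^m)], and
     stability puts that vector in every range. *)
  have := ry (maxn j m).+1; rewrite range_iterS => -[z rz tz].
  have rzm := range_iter_le (leq_maxr j m) rz.
  rewrite -(subrK z x); apply: subspaceD => //.
    apply: (stable_from_null st); first exact: subspaceB.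
    by rewrite linearB/= tx tz subrr.
  exact: range_iter_le (leq_maxl j m) _ rz.
pose x k := iter k g x0.
have rx k j : r j (x k).
  elim: k j => [|k IH] j; first exact: stable_from_null st rx0 tx0 j.
  by have [] := gP _ IH.
have tx k : t (x k.+1) = x k by have [] := gP _ (rx k).
have nx k : nrm (x k) <= c ^+ k * nrm x0.
  elim: k => [|k IH]; first by rewrite mul1r.
  have [_ _ /le_trans] := gP _ (rx k); apply.
  rewrite exprS -mulrA; apply: ler_wpM2l => //; exact: ltW.
(* The first bound keeps [w] in the punctured disc. The second gives [d * c <= 1/4], so that [s] has
   norm at most half that of [x0] and [x0 + s] cannot vanish. *)
pose d := Num.min (rho / 2) (4 * c)^-1.
have d0 : 0 < d by rewrite lt_min divr_gt0// invr_gt0 mulr_gt0.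
have dr : d < rho by rewrite gt_min; apply/orP; left; lra.
have dc : d * c <= 4^-1.
  rewrite -ler_pdivlMr// -invfM.
  by rewrite ge_min lexx orbT.
pose w := real_complex R d.
have cw : cnrm w = d by rewrite cnrm_real// ltW.
pose v k := w ^+ k.+1 *: x k.+1.
have [|s sP] := @nrm_geometric_cvg _ X v (nrm x0 * 4^-1).
  move=> k; rewrite nrmZ cnrmX cw.
  rewrite (le_trans (ler_wpM2l _ (nx _))) ?exprn_ge0 ?(ltW d0)// mulrA -exprMn mulrC.
  rewrite -mulrA; apply: ler_wpM2l; first exact: nrm_ge0.
  have dc0 : 0 <= d * c by rewrite mulr_ge0// ltW.
  rewrite exprS; apply: ler_pM => //; first exact: exprn_ge0.
  by apply: lerXn2r => //; rewrite ?nnegrE; lra.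
have xs0 : x0 + s != 0.
  apply: contraTneq isT => /eqP; rewrite addrC addr_eq0 => /eqP sx.
  have := sP 0%N; rewrite big_ord0 subr0 expr0 sx nrmN.
  by have := nrm_gt0 x00; lra.
apply/negP: xs0; rewrite negbK; apply/eqP; apply: (tinj w); first by rewrite cw d0 dr.
have [b b0 tb] := bop_boundP t.
pose S n := \sum_(k < n) v k.
have tv n : t (v n) = w ^+ n.+1 *: x n.
  by rewrite /v linearZ; congr (_ *: _); exact: tx.
have tS n : t (S n.+1) = w *: (x0 + S n).
  elim: n => [|n IH]; first by rewrite /S big_ord0 addr0 big_ord1 tv expr1.
  have SS k : S k.+1 = S k + v k by rewrite /S big_ord_recr.
  by rewrite SS linearD/= IH tv SS addrA [in RHS]scalerDr scalerA -exprS.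
rewrite linearD/= tx0 add0r; apply/eqP; rewrite -subr_eq0; apply/eqP.
apply: (@nrm_half_exp_eq0 _ _ _ ((b + d) * (nrm x0 * 4^-1 * 2))) => n.
have -> : t s - w *: (x0 + s) = t (s - S n.+1) - w *: (s - S n).
  rewrite linearB/= tS -addrA -opprD -scalerDr; congr (_ - _ *: _).
  by rewrite -addrA [S n + _]addrC subrK.
rewrite (le_trans (nrmD _ _))// nrmN nrmZ cw !mulrDl; apply: lerD.
  rewrite (le_trans (tb _))// -mulrA; apply: ler_wpM2l; first exact: ltW.
  rewrite (le_trans (sP _))//; apply: ler_wpM2l.
    by rewrite !mulr_ge0// nrm_ge0.
  by rewrite exprS ler_piMl ?exprn_ge0//; lra.
rewrite -mulrA; apply: ler_wpM2l (sP n); exact: ltW.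
Qed.

(** That the point is not a limit of the spectrum enters as the absence of eigenvalues in a
    punctured disc. *)
Lemma Bweyl_drazin (rho : R) : 0 < rho ->
  (forall w : R[i], 0 < cnrm w < rho -> forall x, t x = w *: x -> x = 0) ->
  Bweyl t -> drazin t.
Proof.
move=> rho0 tinj [[n [cn [fN fR clT]]] ind0].
have sr := range_iter_subspace t.
have sT k : is_subspace (t @` r k) by rewrite -range_iterS.
have {clT} cn1 : closed (r n.+1).
  have [V cV VE] := (closed_subspaceP _ _).1 clT.
  rewrite range_iterS (_ : t @` r n = V `&` r n); first exact: closedI.
  rewrite VE; apply/esym/setIidPl; rewrite -range_iterS.
  exact: range_iter_le.
have cm j : closed (r (n + j)) /\ closed (r (n + j).+1).
  have [k [e be]] := fN; have eN := basis_mod_span be.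
  elim: j => [|j [IH1 IH2]]; first by rewrite addn0.
  rewrite addnS; split => //; apply: (closed_range_iterS (e := e)) IH1 IH2 => [i|x [rx tx]].
    by have [_ ] := be.1 i.
  by apply: eN; split=> //; apply: range_iter_le rx; exact: leq_addr.
have [m0 /dis_min[std _]] := findim_null_stable fN.
(* From [n] on the ranges are closed, and from [d] on the null parts are stable; [m] has both
   properties. *)
set d := dis t in std; pose m := maxn n d.
have stm : stable_from t m.
  move=> j mj x [rx Nx]; apply: std; first by rewrite (leq_trans (leq_maxr n d)).
  by split=> //; apply: range_iter_le rx; exact: leq_maxr.
have [cm0 cm1] : closed (r m) /\ closed (r m.+1).
  by have := cm (m - n)%N; rewrite subnKC ?leq_maxl.
have injm := no_null_in_stable_range cm0 cm1 stm rho0 tinj.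
have injd x : r d x -> t x = 0 -> x = 0.
  by move=> rx tx; apply: injm => //; exact: stable_from_null std rx tx m.
(* The index is taken at [d] but finite codimension is given at [n]. A generating family is pushed
   forward by [t ^+ (d - n)] if [n <= d], and otherwise pulled back along [t ^+ (n - d)], which is
   injective on [R(t^d)]. *)
have fd : findim (t @` r d) (r d).
  have [k [e be]] := fR; have eN := basis_mod_span be.
  have [nd|/ltnW dn] := leqP n d.
    apply: (@findim_span _ _ _ _ _ (fun i => (t ^+ (d - n)) (e i))) => //.
      by move=> i; rewrite -(subnKC nd) range_iterD subnKC//; exists (e i) => //; case: be.
    move=> x; rewrite -{1}(subnKC nd) range_iterD => -[y /eN[a ya] <-]; exists a.
    rewrite -range_iterS -(subnKC nd) -addSn range_iterD subnKC//.
    rewrite -range_iterS in ya; exists (y - \sum_i a i *: e i) => //.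
    rewrite linearB/= linear_sum; congr (_ - _); apply: eq_bigr => i _.
    by rewrite linearZ.
  have /choice[f fP] i : exists y, r d y /\ (t ^+ (n - d)) y = e i.
    have : r n (e i) by case: be.
    by rewrite -(subnKC dn) range_iterD subnKC// => -[y]; exists y.
  apply: (@findim_span _ _ _ _ _ f) => [//|i|x rx]; first by case: (fP i).
  have [|a] := eN ((t ^+ (n - d)) x).
    by rewrite -{1}(subnKC dn) range_iterD; exists x.
  have nE : n.+1 = (d.+1 + (n - d))%N by rewrite addSn subnKC.
  rewrite -(range_iterS t n) nE range_iterD => -[z rz zE].
  exists a; rewrite -range_iterS.
  suff /eqP : x - \sum_i a i *: f i - z = 0 by rewrite subr_eq0 => /eqP ->.
  apply: (range_exp_inj (j := n - d)) injd _ _.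
    apply: subspaceB => //; last exact: range_iter_le rz.
    apply: subspaceB => //; apply: subspace_sum => // i.
    by apply: subspaceZ => //; case: (fP i).
  rewrite !linearB/= zE linear_sum -addrA -opprD; apply/eqP; rewrite subr_eq0 addrC.
  rewrite [X in _ == _ + X](eq_bigr (fun i => a i *: e i)) ?subrK// => i _.
  by rewrite linearZ/= (fP i).2.
have rd : r d `<=` t @` r d.
  apply: dimq_eq0 fd _; move: ind0; rewrite /Bindex /index_on -/d.
  rewrite (dimq_sub (set0_subspace X)) => [|x [rx tx]]; last exact: injd.
  by rewrite sub0r => /eqP; rewrite oppr_eq0 => /eqP[].
have rj j : r (m + j) = r m.
  by rewrite !(range_iter_stable rd)// ?leq_maxr// (leq_trans (leq_maxr n d))// leq_addr.
(* [A x] is the only [y] in [R(t^m)] with [t^(m+1) y = t^m x]. Uniqueness makes [A] linear and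
   commuting with [t]; open mapping for [t ^+ m.+1] makes it bounded. *)
have /choice[A AP] x : exists y, r m y /\ (t ^+ m.+1) y = (t ^+ m) x.
  have : r (m + m.+1) ((t ^+ m) x) by rewrite rj; exact: range_iter_exp.
  by rewrite range_iterD => -[y]; exists y.
have Auniq x y : r m y -> (t ^+ m.+1) y = (t ^+ m) x -> A x = y.
  move=> ry ty; have [rA tA] := AP x; apply/eqP; rewrite -subr_eq0; apply/eqP.
  apply: (range_exp_inj (j := m.+1)) injm _ _; first exact: subspaceB.
  by rewrite linearB/= tA ty subrr.
have Ab : A \in @bop_pred R X.
  apply/asboolP; split=> [a x y|].
    apply: Auniq; first by apply: (sr m).2; [case: (AP x)|case: (AP y)].
    by rewrite !linearP/= (AP x).2 (AP y).2.
  have := @open_mapping R X (t ^+ m.+1) (r m) (sr m) cm0.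
  rewrite -range_iterD rj => /(_ cm0)[c c0 cP].
  have [b b0 bP] := bop_boundP (t ^+ m).
  exists (c * b) => x; have [y [ry ty yx]] := cP _ (range_iter_exp t m x).
  rewrite (Auniq x y)// (le_trans yx)// -mulrA; apply: ler_wpM2l => //; exact: ltW.
apply: (@drazin_comm_criterion _ t (Bop Ab) m); apply: bopP => x; last first.
  by rewrite bopM/= (AP x).2.
apply/esym; apply: Auniq.
  have : r m.+1 (t (A x)) by rewrite range_iterS; exists (A x); first exact: (AP x).1.
  exact: range_iter_le.
have tE k y : (t ^+ k) (t y) = t ((t ^+ k) y) by rewrite -!bopM -exprSr -exprS.
by rewrite [LHS]tE (AP x).2 -tE.
Qed.

End BWeylDrazin.

(** * Poles of the resolvent *)

Lemma nbhs_cnrmP (R : realType) (l : (R[i] : numFieldType)) (U : set (R[i] : numFieldType)) :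
  nbhs l U <-> exists2 rho : R, 0 < rho & forall z : R[i], cnrm (z - l) < rho -> U z.
Proof.
split=> [/nbhs_ballP[e e0 eU]|[rho rho0 rU]].
  have eE : real_complex R (complex.Re e) = e by rewrite RRe_real ?gtr0_real.
  exists (complex.Re e); first by rewrite -ltcR eE.
  by move=> z zl; apply: eU; rewrite -ball_normE/= distrC cnrmE -eE ltcR.
apply/nbhs_ballP; exists (real_complex R rho).
  by rewrite /= -[0]/(real_complex R 0) ltcR.
by move=> z; rewrite -ball_normE/= distrC cnrmE ltcR => /rU.
Qed.

Section Poles.
Variables (R : realType) (X : completeNormedModType R[i]).
Implicit Types (t a s : bop X) (w : R[i]).
Local Notation I := (1 : bop X).

Lemma bop_of_inverse t :
  (exists S, inverse_op t S) <-> exists s, s * t = 1 /\ t * s = 1.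
Proof.
split=> [[S [Sb tS St]]|[s [st ts]]].
  by exists (bop_of Sb); split; apply: bopP => x; [exact: tS|exact: St].
exists s; split; first exact: bop_bounded.
  by move=> x; rewrite -[LHS]bopM st.
by move=> x; rewrite -[LHS]bopM ts.
Qed.

(** Lets the definitions on bundled linear maps be rewritten as expressions in the ring of bounded
    operators. *)
Lemma linear_ext (f g : {linear X -> X}) : f =1 g -> f = g.
Proof.
move=> /funext; case: f => f [[f1] [f2]]; case: g => g [[g1] [g2]] /= fg.
rewrite -fg in g1 g2 *.
by rewrite (Prop_irrelevance f1 g1) (Prop_irrelevance f2 g2).
Qed.

Lemma sub_scalarE t (l : R[i]) : sub_scalar t l = (t - l *: I : bop X).
Proof. exact: linear_ext. Qed.

Lemma drazin_invertibleP t : drazin_invertible t <-> drazin t.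
Proof.
split=> [[A [k [Ab tA At tAt]]]|[a [k [tA At tAt]]]].
  exists (bop_of Ab), k; split; apply: bopP => x; rewrite ?bopM ?bopX.
  - exact: tA.
  - exact: At.
  - exact: tAt.
exists a, k; split=> [|x|x|x].
- exact: bop_bounded.
- by have := congr1 (fun f : bop X => f x) tA; rewrite !bopM !bopX.
- exact: (congr1 (fun f : bop X => f x) At).
- exact: (congr1 (fun f : bop X => f x) tAt).
Qed.

Lemma comm_inverse (E : pzRingType) (x b c : E) :
  c * b = 1 -> b * c = 1 -> GRing.comm x b -> GRing.comm x c.
Proof.
move=> cb bc xb; rewrite /GRing.comm.
by rewrite -[x * c]mul1r -cb -mulrA (mulrA b) -xb -mulrA bc mulr1.
Qed.

Lemma comm_bopZ (f g : bop X) w : GRing.comm f g -> GRing.comm f (w *: g).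
Proof. by rewrite /GRing.comm -bop_scaleAr -bop_scaleAl => ->. Qed.

Lemma bop_exprZ w (f : bop X) n : (w *: f) ^+ n = w ^+ n *: f ^+ n.
Proof.
elim: n => [|n IH]; first by rewrite !expr0 scale1r.
by rewrite !exprS IH -bop_scaleAl -bop_scaleAr scalerA.
Qed.

Definition nrm_cvg (u : nat -> X) (l : X) :=
  forall e : R, 0 < e -> exists N, forall n, (N <= n)%N -> nrm (u n - l) < e.

(* The coefficients of the expansion of [h w - w *: g w = w ^+ p *: x]. *)
Lemma power_series_shift (al be : nat -> X) (h g : R[i] -> X) (x : X) (p : nat) (rho : R) :
  0 < rho ->
  (forall w, 0 < cnrm w < rho ->
    [/\ nrm_cvg (fun N => \sum_(n < N) w ^+ n *: al n) (h w),
        nrm_cvg (fun N => \sum_(n < N) w ^+ n *: be n) (g w) &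
        h w - w *: g w = w ^+ p *: x]) ->
  al 0%N = (0 == p)%N%:R *: x /\
  forall n, al n.+1 = be n + (n.+1 == p)%N%:R *: x.
Proof.
move=> rho0 H.
pose b n := al n - (if n is n'.+1 then be n' else 0) - (n == p)%:R *: x.
suff b0 m : b m = 0.
  split=> [|n]; apply/eqP; rewrite -subr_eq0; apply/eqP.
    by rewrite -[RHS](b0 0%N) /b subr0.
  by rewrite -[RHS](b0 n.+1) /b opprD addrA.
apply: (power_series_eq0 rho0) => w wr e e0; have [ah bg hg] := H w wr.
have c1 : 0 < 1 + cnrm w by rewrite ltr_pwDl// cnrm_ge0.
have [N1 h1] := ah _ (divr_gt0 e0 c1); have [N2 h2] := bg _ (divr_gt0 e0 c1).
(* Going past [p] ensures that the partial sum contains the term [w ^+ p *: x]; the factor [w] makes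
   [n] terms of [be] face [n.+1] terms of [al]. *)
exists (maxn (maxn N1 N2) p).+1 => -[//|n]; rewrite ltnS !geq_max => /andP[/andP[n1 n2] pn].
have -> : \sum_(k < n.+1) w ^+ k *: b k =
    (\sum_(k < n.+1) w ^+ k *: al k - h w) - w *: (\sum_(k < n) w ^+ k *: be k - g w).
  rewrite /b; under eq_bigr do rewrite !scalerBr.
  rewrite !sumrB [in X in _ - X - _]big_ord_recl/= scaler0 add0r.
  have -> : \sum_(i < n.+1) w ^+ i *: ((i == p :> nat)%:R *: x) = w ^+ p *: x.
    have pn1 : (p < n.+1)%N by [].
    rewrite (bigD1 (Ordinal pn1))//= eqxx scale1r big1 ?addr0// => i ip.
    by rewrite (_ : (i == p :> nat) = false) ?scale0r ?scaler0//; apply: negPf.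
  have -> : \sum_(i < n) w ^+ bump 0 i *: be i = w *: \sum_(i < n) w ^+ i *: be i.
    by rewrite scaler_sumr; apply: eq_bigr => i _; rewrite scalerA -exprS.
  rewrite -hg scalerBr !opprB addrACA [RHS]addrACA; congr (_ + _).
  exact: addrC.
rewrite (le_lt_trans (nrmD _ _))// nrmN nrmZ.
have eE : e = e / (1 + cnrm w) + cnrm w * (e / (1 + cnrm w)).
  by field; rewrite gt_eqF.
rewrite [ltRHS]eE ltr_leD//; first exact: h1 (leqW n1).
by apply: ler_wpM2l; [exact: cnrm_ge0|exact/ltW/h2].
Qed.

Lemma nrm_cvg_bop t (u : nat -> X) (l : X) : nrm_cvg u l -> nrm_cvg (fun n => t (u n)) (t l).
Proof.
move=> ul e e0; have [c c0 tc] := bop_boundP t.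
have [N NP] := ul _ (divr_gt0 e0 c0); exists N => n /NP h.
by rewrite -linearB (le_lt_trans (tc _))// mulrC -ltr_pdivlMr.
Qed.

Lemma pole_drazin t0 (l : R[i]) : poles t0 l -> drazin (t0 - l *: I).
Proof.
move=> [p [p0 [_ [A [rK [Ab _ rK0 HA]]]]]]; set t := t0 - _.
pose B n := bop_of (Ab n).
pose r := complex.Re rK.
have rE : real_complex R r = rK by rewrite RRe_real ?gtr0_real.
have r0 : 0 < r by rewrite -ltcR rE.
have /choice[s sP] w : exists s, 0 < cnrm w < r -> [/\ s * (t - w *: I) = 1,
    (t - w *: I) * s = 1 &
    forall x, nrm_cvg (fun N => \sum_(n < N) w ^+ n *: B n x) (w ^+ p *: s x)].
  have [wr|] := pselect (0 < cnrm w < r); last by exists 0.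
  have w0 : w != 0.
    by apply: contraTneq wr => ->; rewrite /cnrm normr0 ltxx.
  have [|S [[Sb St tS] SA]] := HA (l + w).
    by rewrite addrC addKr cnrmE -rE -[0]/(real_complex R 0) !ltcR.
  have uE x : sub_scalar t0 (l + w) x = (t - w *: I) x.
    by rewrite !bopB !bopZ bop1 -addrA -opprD -scalerDl.
  exists (bop_of Sb) => _; split.
  - by apply: bopP => x; rewrite bopM -uE; exact: St.
  - by apply: bopP => x; rewrite bopM -uE; exact: tS.
  move=> x e e0; pose M := cnrm (w ^+ p) * nrm x + 1.
  have M0 : 0 < M by rewrite ltr_wpDl// mulr_ge0 ?nrm_ge0 ?cnrm_ge0.
  have eM : 0 < real_complex R (e / M) by rewrite -[0]/(real_complex R 0) ltcR divr_gt0.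
  have [N _ NP] := SA _ eM; exists N => n /NP /(_ x).
  rewrite (addrC l w) addrK !nrmE -rmorphM lecR => h.
  have -> : \sum_(n0 < n) w ^+ n0 *: B n0 x - w ^+ p *: bop_of Sb x =
     w ^+ p *: ((w ^- p) *: (\sum_(n0 < n) w ^+ n0 *: A n0 x) - S x).
    by rewrite scalerBr scalerA mulfV ?expf_neq0// scale1r.
  rewrite nrmZ (le_lt_trans (ler_wpM2l (cnrm_ge0 _) h))//.
  rewrite mulrCA mulrAC -mulrA gtr_pMr// ltr_pdivrMr// mul1r /M mulrC; lra.
have tB x : t (B 0%N x) = (0 == p)%N%:R *: x /\
    forall n, t (B n.+1 x) = B n x + (n.+1 == p)%N%:R *: x.
  apply: (@power_series_shift (fun n => t (B n x)) (fun n => B n x) (fun w => t (w ^+ p *: s w x))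
    (fun w => w ^+ p *: s w x) x p r r0) => w /sP[_ ts sB]; split=> //.
    move=> e /(nrm_cvg_bop t (sB x))[N NP]; exists N => n /NP.
    rewrite linear_sum; congr (nrm (_ - _) < e).
    by apply: eq_bigr => i _; rewrite linearZ.
  rewrite -[LHS]/((t - w *: I) (w ^+ p *: s w x)) linearZ; congr (_ *: _).
  by rewrite -[LHS]bopM ts.
have Bt x : B 0%N (t x) = (0 == p)%N%:R *: x /\
    forall n, B n.+1 (t x) = B n x + (n.+1 == p)%N%:R *: x.
  apply: (@power_series_shift (fun n => B n (t x)) (fun n => B n x)
    (fun w => w ^+ p *: s w (t x))
    (fun w => w ^+ p *: s w x) x p r r0) => w /sP[st _ sB]; split=> //.
  rewrite scalerA mulrC -scalerA -scalerBr -linearZ -linearB; congr (_ *: _).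
  by rewrite -[RHS]/((1 : bop X) x) -st.
(* From here the order is [p.+1]. The relations read [t B_0 = 0], then [t B_(n+1) = B_n] up to an
   extra identity at [n = p], so [t ^+ p.+1] kills [B p]. *)
case: p p0 tB Bt {HA sP} => // p _ tB Bt.
have comm n : GRing.comm t (B n).
  apply: bopP => x; rewrite !bopM; case: n => [|n].
    by rewrite (tB x).1 (Bt x).1.
  by rewrite (tB x).2 (Bt x).2.
have nil n : (n <= p)%N -> t ^+ n.+1 * B n = 0.
  elim: n => [|n IH] np; first by apply: bopP => x; rewrite bopM (tB x).1 scale0r.
  rewrite exprSr -mulrA (_ : t * B n.+1 = B n) ?IH// 1?ltnW//.
  by apply: bopP => x; rewrite bopM (tB x).2 eqSS ltn_eqF// scale0r addr0.
apply: (drazin_comm_criterion (p := p.+1) (comm p.+1)).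
rewrite exprSr -mulrA (_ : t * B p.+1 = B p + 1).
  by rewrite mulrDr nil// add0r mulr1.
by apply: bopP => x; rewrite bopM (tB x).2 eqxx scale1r.
Qed.

(** With [Q = 1 - t * a], the resolvent at [w] is [a * (1 - w *: a)^-1] minus the finite sum of
    [w^-1 ^+ j.+1 *: (t ^+ j * Q)]. The order [p] of the pole is the least exponent with
    [t ^+ p * Q = 0], and nonzero values of [t ^+ p.-1 * Q] are eigenvectors. *)
Lemma drazin_pole t0 (l : R[i]) :
  spectrum t0 l -> drazin (t0 - l *: I) -> poles t0 l /\ eigenvalues t0 l.
Proof.
move=> spl; set t := t0 - _ => -[a [k ta]].
have [_ tkP aP _] := drazin_idem ta; case: ta => tka ata ta.
pose Q := 1 - t * a.
have tQ : GRing.comm t Q.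
  by apply: commrB; [exact: commr1|apply: commrM].
have ex : exists n, t ^+ n * Q == 0 by exists k; rewrite mulrBr mulr1 tkP subrr.
case: (ex_minnP ex) => p /eqP tpQ pmin.
(* Exponent 0 would mean [Q = 0], making [a] an inverse of [t], although [l] is in the spectrum. *)
have p0 : (0 < p)%N.
  rewrite lt0n; apply/negP => /eqP p0; apply: spl; rewrite sub_scalarE.
  apply/bop_of_inverse; exists a; move: tpQ; rewrite p0 mul1r => /eqP.
  by rewrite subr_eq0 => /eqP ta1; rewrite -ta -ta1.
have tQ0 : t ^+ p.-1 * Q != 0.
  by apply/negP => /pmin; rewrite -ltnS prednK// ltnn.
have [y tQy] : exists y, (t ^+ p.-1 * Q) y != 0.
  apply: contrapT => H; move/eqP: tQ0; apply; apply: bopP => y.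
  by apply: contrapT => /eqP yH; apply: H; exists y.
split; last first.
  exists ((t ^+ p.-1 * Q) y); split=> //.
  have : t ((t ^+ p.-1 * Q) y) = 0 by rewrite -bopM mulrA -exprS prednK// tpQ.
  by rewrite bopB bopZ bop1 => /eqP; rewrite subr_eq0 => /eqP.
have [c c0 ac] := bop_boundP a.
pose rho := (2 * c)^-1.
have rho0 : 0 < rho by rewrite invr_gt0 mulr_gt0.
(* Coefficients of the resolvent multiplied by [w ^+ p]: first the principal part in reverse order,
   then the Neumann series of [a]. *)
pose A n : bop X := if (n < p)%N then - (t ^+ (p.-1 - n) * Q) else a ^+ (n - p).+1.
have key w : 0 < cnrm w < rho -> exists s, [/\ s * (t - w *: I) = 1,
    (t - w *: I) * s = 1 &
    forall M x, nrm (w ^- p *: (\sum_(n < p + M) w ^+ n *: A n x) - s x)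
       <= c * (nrm x * 2 * 2^-1 ^+ M)].
  move=> /andP[w0 wr]; have w1 : w != 0.
    by apply: contraTneq w0 => ->; rewrite /cnrm normr0 ltxx.
  have [|s [sw ws sP]] := @neumann _ _ (w *: a).
    move=> x; rewrite bopZ nrmZ (le_trans (ler_wpM2l (cnrm_ge0 _) (ac _)))// mulrA.
    apply: ler_wpM2r; first exact: nrm_ge0.
    rewrite -ler_pdivlMr// -invfM ltW//.
  pose N : bop X := \sum_(j < p) w^-1 ^+ j.+1 *: (t ^+ j * Q).
  have tN : (t - w *: I) * N = - Q.
    (* Each term of the product is [f j.+1 - f j]; the sum telescopes to [f p - f 0 = - Q]. *)
    pose f j : bop X := w^-1 ^+ j *: (t ^+ j * Q).
    rewrite mulr_sumr (eq_bigr (fun j : 'I_p => f j.+1 - f j)) => [|j _].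
      rewrite -(big_mkord xpredT (fun j => f j.+1 - f j)) telescope_sumr//.
      by rewrite /f tpQ scaler0 !expr0 scale1r mul1r sub0r.
    rewrite /f -bop_scaleAr mulrBl scalerBr mulrA -exprS; congr (_ - _).
    by rewrite -bop_scaleAl mul1r scalerA exprSr mulfVK.
  have tas : (t - w *: I) * (a * s) = t * a.
    rewrite mulrA (_ : (t - w *: I) * a = t * a * (1 - w *: a)).
      by rewrite -mulrA ws mulr1.
    by rewrite mulrBl mulrBr mulr1 -bop_scaleAl mul1r -bop_scaleAr {3}ta ata.
  have tS : (t - w *: I) * (a * s - N) = 1.
    by rewrite mulrBr tas tN opprK /Q addrC subrK.
  have comm_tS : GRing.comm (t - w *: I) (a * s - N).
    apply/commr_sym/commrB; last exact/comm_bopZ/commr1.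
    have ts : GRing.comm t s.
      by apply: comm_inverse sw ws _; apply: commrB; [exact: commr1|exact: comm_bopZ].
    apply/commr_sym/commrB; first exact: commrM.
    apply: commr_sum => j _; apply/comm_bopZ/commrM => //.
    exact/commrX/commr_refl.
  exists (a * s - N); split; [by rewrite -comm_tS|by []|].
  move=> M x.
  have -> : w ^- p *: (\sum_(n < p + M) w ^+ n *: A n x) =
      a ((\sum_(m < M) (w *: a) ^+ m) x) - N x.
    rewrite big_split_ord/= scalerDr addrC; congr (_ + _).
      rewrite (bop_sum _ (fun m => (w *: a) ^+ m)) scaler_sumr linear_sum.
      apply: eq_bigr => m _; rewrite /A ltnNge leq_addr/= addKn scalerA exprD.
      by rewrite mulKf ?expf_neq0// bop_exprZ bopZ linearZ/= exprS.
    rewrite (bop_sum _ (fun j => w^-1 ^+ j.+1 *: (t ^+ j * Q))) scaler_sumr.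
    rewrite (reindex_inj rev_ord_inj)/= -sumrN; apply: eq_bigr => j _.
    have jp : (j < p)%N by [].
    rewrite /A /= ltn_subrL p0 (_ : p.-1 - (p - j.+1) = j)%N; last first.
      by rewrite -{1}(subnK jp) addnS/= addKn.
    rewrite bopN !scalerN scalerA; congr (- (_ *: _)).
    by rewrite -{1}(subnK jp) exprD invfM mulrAC mulVf ?expf_neq0// mul1r exprVn.
  rewrite bopB bopM opprB addrA subrK -linearB (le_trans (ac _))//.
  by rewrite nrm_distC; apply: ler_wpM2l => //; exact: ltW.
have rhoC : 0 < real_complex R rho by rewrite -[0]/(real_complex R 0) ltcR.
have shift z : sub_scalar t0 z = (t - (z - l) *: I : bop X).
  apply: linear_ext => x; rewrite -[LHS]/(t0 x - z *: x) -[RHS]/(t0 x - l *: x - (z - l) *: x).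
  by rewrite scalerBl opprB addrA subrK.

exists p; split=> //; split.
  split; first exact/mem_set.
  exists [set z | cnrm (z - l) < rho].
    by apply/nbhs_cnrmP; exists rho.
  apply/seteqP; split=> z /=; last first.
    by move=> ->; split=> //; rewrite subrr /cnrm normr0.
  move=> [zl spz]; apply: contrapT => zl0.
  apply: spz; rewrite shift; apply/bop_of_inverse.
  have [|s [? ? _]] := key (z - l); last by exists s.
  rewrite zl andbT.
  by apply: cnrm_gt0; rewrite subr_eq0; apply/eqP.
exists (fun n => A n), (real_complex R rho); split=> //.
- by move=> n; exact: bop_bounded.
- by exists y; rewrite -[X in X != 0]/(A 0%N y) /A p0 subn0 bopN oppr_eq0.
move=> z; rewrite cnrmE -[0]/(real_complex R 0) !ltcR => /key[s [st ts sP]].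
exists s; split.
  rewrite shift; split; first exact: bop_bounded.
    by move=> x; rewrite -[LHS]bopM st.
  by move=> x; rewrite -[LHS]bopM ts.
move=> e e0; have eE : real_complex R (complex.Re e) = e by rewrite RRe_real ?gtr0_real.
have er0 : 0 < complex.Re e by rewrite -ltcR eE.
have [M MP] := half_exp_small (divr_gt0 er0 (mulr_gt0 c0 (@ltr0n R 2))).
exists (p + M)%N => // n /= pMn x.
rewrite -eE !nrmE -rmorphM lecR.
have pn : (p <= n)%N := leq_trans (leq_addr _ _) pMn.
have Mn : (M <= n - p)%N by rewrite leq_subRL.
have := sP (n - p)%N x; rewrite subnKC// => /le_trans; apply.
rewrite mulrCA -!mulrA mulrC; apply: ler_wpM2r; first exact: nrm_ge0.
move: MP; rewrite ltr_pdivlMr ?mulr_gt0// => MP.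
have : 2^-1 ^+ (n - p) <= 2^-1 ^+ M :> R.
  by rewrite -(subnKC Mn) exprD ler_piMr ?exprn_ge0// exprn_ile1//; lra.
by move=> /(ler_wpM2l (ltW c0)); lra.
Qed.

End Poles.

(** * Comparison of the spectra *)

Section Spectra.
Variables (R : realType) (X : completeNormedModType R[i]).
Implicit Types (t : bop X) (l : R[i]).
Local Notation I := (1 : bop X).

Lemma Bbrowder_drazin_spectrum t : Bbrowder_spectrum t = drazin_spectrum t.
Proof.
apply/seteqP; split=> l.
  have tE : ((t : {linear X -> X}) \+ (0 : bop X) : {linear X -> X}) = t.
    by apply: linear_ext => x; rewrite /= addr0.
  move=> /(_ (0 : bop X)); rewrite tE; apply; split=> [|x]; last by rewrite /= linear0.
  split; first exact: bop_bounded.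
  by apply: findim_sub; [exact: set0_subspace|move=> _ [x _ <-]].
rewrite /drazin_spectrum /mkset sub_scalarE => ntl F [[Fb Ff] tF].
apply: contra_not ntl; pose f := bop_of Fb.
have -> : sub_scalar ((t : {linear X -> X}) \+ F) l = (t - l *: I + f : bop X).
  by apply: linear_ext => x; rewrite -[LHS]/(t x + F x - l *: x) addrAC.
move=> /drazin_invertibleP tfD; apply/drazin_invertibleP.
have uf : GRing.comm (t - l *: I) f.
  apply/commr_sym/commrB; last exact/comm_bopZ/commr1.
  by apply: bopP => x; apply/esym; exact: tF.
have [|j [n [c cE]]] := @finite_rank_recurrence _ X (t - l *: I : bop X) f Ff.
  by move=> x; exact: (congr1 (fun g : bop X => g x) uf).
(* The recurrence on the range of [f] supplies the correcting polynomial in [t - l *: I]. *)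
apply: (@drazin_perturb _ _ f (\sum_(i < n) c i *: (t - l *: I) ^+ i) j) => //.
  by apply: commr_sum => i _; exact/comm_bopZ/commrX/commr_refl.
apply: bopP => x; rewrite [RHS]bopM bopX cE mulr_sumr mulr_suml.
rewrite (bop_sum _ (fun i => (t - l *: I) ^+ j.+1 * (c i *: (t - l *: I) ^+ i) * f)).
apply: eq_bigr => i _; rewrite -bop_scaleAr -exprD -bop_scaleAl.
by rewrite addSn -bopX.
Qed.

Lemma not_spectrumP t l : ~ spectrum t l -> exists s, s * (t - l *: I) = 1 /\ (t - l *: I) * s = 1.
Proof. by move=> /contrapT; rewrite sub_scalarE => /bop_of_inverse. Qed.

Lemma not_spectrum_drazin t l : ~ spectrum t l -> drazin (t - l *: I).
Proof.
move=> /not_spectrumP[s [st ts]]; exists s, 0%N; split.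
- by rewrite mul1r st.
- by rewrite st mul1r.
- by rewrite st ts.
Qed.

(** The resolvent set is open: if [s] inverts [t - l], then [t - z] is [(t - l) (1 - (z - l) s)],
    whose last factor has a Neumann inverse for [z] near [l]. *)
Lemma limit_point_spectrum t : limit_point (spectrum t) `<=` spectrum t.
Proof.
move=> l ll; apply: contrapT => /not_spectrumP[s [st ts]].
have [c c0 sc] := bop_boundP s.
have [z [zl spz zU]] : exists y, [/\ y != l, spectrum t y & cnrm (y - l) < (2 * c)^-1].
  apply: (ll [set z | cnrm (z - l) < (2 * c)^-1]); apply/nbhs_cnrmP.
  by exists (2 * c)^-1 => //; rewrite invr_gt0 mulr_gt0.
have [|v [vs sv _]] := @neumann _ _ ((z - l) *: s).
  move=> x; rewrite bopZ nrmZ (le_trans (ler_wpM2l (cnrm_ge0 _) (sc _)))// mulrA.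
  apply: ler_wpM2r; first exact: nrm_ge0.
  by rewrite -ler_pdivlMr// -invfM ltW.
apply: spz; rewrite sub_scalarE; apply/bop_of_inverse.
have -> : t - z *: I = (t - l *: I) * (1 - (z - l) *: s).
  by rewrite mulrBr mulr1 -bop_scaleAr ts scalerBl opprB addrA subrK.
exists (v * s); split.
  by rewrite mulrA -(mulrA v) st mulr1.
by rewrite mulrA -(mulrA (t - _)) sv mulr1.
Qed.

Lemma Bweyl_not_limit_drazin t l :
  ~ Bweyl_spectrum t l -> ~ limit_point (spectrum t) l -> drazin (t - l *: I).
Proof.
move=> /contrapT; rewrite sub_scalarE not_limit_pointE => lW [U /nbhs_cnrmP[rho rho0 rU] sU].
apply: Bweyl_drazin rho0 _ lW => w /andP[w0 wr] x txw.
have [spl|/not_spectrumP[s [st _]]] := pselect (spectrum t (l + w)).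
  have /sU lwl : (spectrum t `&` U) (l + w).
    by split=> //; apply: rU; rewrite addrC addKr.
  move: w0; rewrite (_ : w = 0) /cnrm ?normr0 ?ltxx//.
  by apply: (addrI l); rewrite addr0.
rewrite -[x]bop1 -st bopM bopB bopZ bop1 scalerDl opprD addrA.
by rewrite -[l *: x]/((l *: I) x) -bopB txw subrr linear0.
Qed.

Lemma Bweyl_spectrum_drazin t l : drazin (t - l *: I) -> ~ Bweyl_spectrum t l.
Proof. by move=> tl; apply; rewrite sub_scalarE; exact: drazin_Bweyl. Qed.

Lemma drazin_spectrumP t l : drazin_spectrum t l <-> ~ drazin (t - l *: I).
Proof. by rewrite /drazin_spectrum /mkset sub_scalarE drazin_invertibleP. Qed.

End Spectra.

(** * The cycle of implications *)

Theorem theorem2p1 (R : realType) (X : completeNormedModType R[i])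
    (infinite_dim : ~ findim [set 0] [set: X])
    (T : {linear X -> X}) (T_bounded : bounded_op T) :
  [<-> spectrum T `\` Bweyl_spectrum T = poles T;
       Bweyl_spectrum T = Bbrowder_spectrum T;
       spectrum T = Bweyl_spectrum T `|` isolated_eigenvalues T;
       limit_point (spectrum T) `<=` Bweyl_spectrum T;
       spectrum T `\` Bweyl_spectrum T `<=` isolated_eigenvalues T].
Proof.
rewrite {infinite_dim} (_ : T = bop_of T_bounded); last exact: linear_ext.
move: (bop_of _) => {T T_bounded} t.
have isoNlim l : isolated (spectrum t) l -> ~ limit_point (spectrum t) l.
  by move=> li ll; have /disj_setPS/(_ l) := disjoint_isolated_limit_point (spectrum t); apply.
have spW l : Bweyl_spectrum t l -> spectrum t l.
  by apply: contraPP => /not_spectrum_drazin/Bweyl_spectrum_drazin.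
tfae.
(* A spectral point off the B-Weyl spectrum is a pole by hypothesis, hence not in the Drazin
   spectrum; the other inclusion holds unconditionally. *)
- move=> polesE; rewrite Bbrowder_drazin_spectrum; apply/seteqP; split=> l.
    by move=> Wl; apply/drazin_spectrumP => /Bweyl_spectrum_drazin.
  move=> /drazin_spectrumP; apply: contra_notP => nWl.
  have [spl|/not_spectrum_drazin//] := pselect (spectrum t l).
  by apply: pole_drazin; rewrite -polesE.
- rewrite Bbrowder_drazin_spectrum => WD; apply/seteqP; split=> l.
    move=> spl; have [Wl|nWl] := pselect (Bweyl_spectrum t l); [by left|right].
    move: nWl; rewrite WD => /drazin_spectrumP/contrapT.
    by move=> /(drazin_pole spl)[[p [_ [? _]]] ?].
  by case=> [/spW//|[_ /isolatedS]].
(* The spectrum contains its limit points, and these are not isolated, so only the B-Weyl part of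
   the union remains. *)
- move=> spE l ll; have := limit_point_spectrum ll; rewrite {1}spE => -[//|].
  by move=> [_ /isoNlim/(_ ll)].
- move=> limW l [spl nWl].
  have nlim : ~ limit_point (spectrum t) l by move=> /limW.
  have [[p [_ [? _]]] ?] := drazin_pole spl (Bweyl_not_limit_drazin nWl nlim).
  by split.
(* By hypothesis the point is isolated, so being B-Weyl yields Drazin invertibility and thus a pole;
   conversely a pole is Drazin and hence B-Weyl. *)
- move=> spW0; apply/seteqP; split=> l.
    move=> [spl nWl]; have [_ /isoNlim nlim] := spW0 l (conj spl nWl).
    by have [] := drazin_pole spl (Bweyl_not_limit_drazin nWl nlim).
  move=> pl; split; last exact/Bweyl_spectrum_drazin/pole_drazin.
  by case: pl => p [_ [/isolatedS]].
Qed.
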